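(* Let $\Lambda\in\mathbb C^{n\times n}$ be a Hermitian matrix, let $(A,B)\in\mathbb C^{n\times n}\times\mathbb C^{n\times m}$ be a reachable pair of matrices with $B$ having rank $m$ and with the spectrum of $A$ contained in the open unit disc, and let $$G(z):=(I-zA)^{-1}B .$$ If $$p(z)=G(z)^*\Lambda G(z)$$ is positive definite for all $z=e^{i\theta}$ with $\theta\in[0,2\pi]$, then there exists a factorization $$p(z)=\sigma(z)^*\,\Omega\,\sigma(z)=G(z)^*C^*\,\Omega\, C G(z),\qquad \sigma(z):=CG(z),$$ for a unique pair $(C,\Omega)$, with $C\in\mathbb C^{m\times n}$ and $\Omega\in\mathbb C^{m\times m}$ Hermitian non-negative definite, satisfying (i) $CB=I$ (the $m\times m$ identity); (ii) $\Omega$ is a positive definite matrix; (iii) the rational function $\det(\sigma(z))$ has no root in the closed unit disc $\{z\in\mathbb C: |z|\le 1\}$.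
   Context: For a constant matrix, $^*$ denotes complex conjugate transpose. For a rational matrix function $G(z)$, $G(z)^*$ denotes the para-conjugate $G^*(z^{-1})$, obtained by conjugate-transposing the coefficients of $G$ and replacing $z$ by $z^{-1}$; thus for $z=e^{i\theta}$ on the unit circle, $G(z)^*$ is the ordinary conjugate transpose of the matrix $G(e^{i\theta})$. The pair $(A,B)$ is reachable if $[B,\ AB,\ \ldots,\ A^{n-1}B]$ has rank $n$. Since the spectrum of $A$ lies in the open unit disc, $G(z)$ is analytic in the closed unit disc. *)

(* Defs.v *)
From HB Require Import structures.
From mathcomp Require Import all_boot all_order all_algebra.
From mathcomp Require Import complex.
From mathcomp Require Import all_classical all_reals all_analysis.

Set Implicit Arguments.
Unset Strict Implicit.
Unset Printing Implicit Defensive.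

Import Order.TTheory GRing.Theory Num.Theory.

Local Open Scope ring_scope.
Local Open Scope complex_scope.
Local Open Scope sesquilinear_scope.

Definition expi (R : realType) (theta : R) : R[i] :=
  cos theta +i* sin theta.

Section Matrices.
Variable K : numClosedFieldType.

(* In [K], [0 < a] and [0 <= a] include the fact that [a] is real. *)
Definition posdefmx (n : nat) (M : 'M[K]_n) : Prop :=
  M \is hermsymmx /\
  forall x : 'cV[K]_n, x != 0 -> 0 < (x ^t* *m M *m x) 0 0.

Definition possemidefmx (n : nat) (M : 'M[K]_n) : Prop :=
  M \is hermsymmx /\
  forall x : 'cV[K]_n, 0 <= (x ^t* *m M *m x) 0 0.

Definition reachable (n m : nat) (A : 'M[K]_n) (B : 'M[K]_(n, m)) : Prop :=
  \rank (\mxrow_(k < n) (A ^+ k *m B)) = n.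

Definition spectrum_in_open_disc (n : nat) (A : 'M[K]_n) : Prop :=
  forall a : K, eigenvalue A a -> `|a| < 1.

(* Rational matrix functions are represented by their values.  Conjugating
   the coefficients of [F] turns [F] into [z |-> conj (F (conj z))], so that
   the para-conjugate [F^*(z^-1)] is the conjugate transpose of
   [F ((conj z)^-1)].  At [z = 0], where [0^-1 = 0], and at poles, the value
   is meaningless. *)
Definition paraconj (p q : nat) (F : K -> 'M[K]_(p, q)) : K -> 'M[K]_(q, p) :=
  fun z => (F (z^*)^-1) ^t*.

Definition transfer (n m : nat) (A : 'M[K]_n) (B : 'M[K]_(n, m)) :
    K -> 'M[K]_(n, m) :=
  fun z => invmx (1%:M - z *: A) *m B.

(* [invmx] is only meaningful on [unitmx]: at a nonzero [z], these are the
   conditions under which [transfer A B z] and [paraconj (transfer A B) z]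
   are genuine values of the rational functions.  They exclude finitely many
   points only, so that two rational functions in the entries of [transfer A B]
   and [paraconj (transfer A B)] are equal iff they agree at all such [z]. *)
Definition regular_point (n : nat) (A : 'M[K]_n) (z : K) : Prop :=
  [/\ z != 0, 1%:M - z *: A \in unitmx
    & 1%:M - (z^*)^-1 *: A \in unitmx].

End Matrices.

(* Main.v *)
(* Let x_0 = B u_0, x_(k+1) = A x_k + B u_(k+1).  On the unit circle p >= e for
   some e > 0 by compactness; by Parseval on roots of unity, applied to periodic
   trajectories of growing period, sum_k x_k^* Lambda x_k >= e sum_k |u_k|^2.
   Hence the Riccati iteration started at the solution of the Stein equation
   Q_0 - A^* Q_0 A = Lambda decreases, is bounded below by reachability, and
   converges to a fixed point Q with the same lower bound.  With
   Omega = B^* Q B, C = Omega^-1 B^* Q and P = Q - C^* Omega C one has P B = 0 and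
   Lambda = C^* Omega C + P - A^* P A, which is the factorization.  If C G(z) had
   a kernel vector with |z| <= 1, it would produce controls of unbounded energy
   and constant cost.
   Conversely every factorization comes from such a P: G^* (P - A^* P A) G = 0
   on the circle forces P B = 0.  For two of them, P_1 - P_2 = D satisfies
   D = (A (1 - B C_1))^* D (A (1 - B C_2)) with both factors stable, so D = 0. *)
Require Import Defs.
From HB Require Import structures.
From mathcomp Require Import all_boot all_order all_algebra.
From mathcomp Require Import complex.
From mathcomp Require Import all_classical all_reals all_analysis.
From mathcomp Require Import ring lra.

Set Implicit Arguments.
Unset Strict Implicit.
Unset Printing Implicit Defensive.

Import Order.TTheory GRing.Theory Num.Theory.
Import numFieldNormedType.Exports ComplexField.Normc.

Local Open Scope ring_scope.
Local Open Scope sesquilinear_scope.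
Local Open Scope classical_set_scope.

(** * Sesquilinear forms *)

Section SesquilinearForms.
Variable K : numClosedFieldType.
Implicit Types m n p : nat.

Lemma adjmxM m n p (A : 'M[K]_(m, n)) (B : 'M[K]_(n, p)) :
  (A *m B) ^t* = B ^t* *m A ^t*.
Proof. by rewrite trmx_mul map_mxM. Qed.

Lemma adjmxD m n (A B : 'M[K]_(m, n)) : (A + B) ^t* = A ^t* + B ^t*.
Proof. by rewrite linearD map_mxD. Qed.

Lemma adjmxN m n (A : 'M[K]_(m, n)) : (- A) ^t* = - A ^t*.
Proof. by rewrite linearN map_mxN. Qed.

Lemma adjmxB m n (A B : 'M[K]_(m, n)) : (A - B) ^t* = A ^t* - B ^t*.
Proof. by rewrite adjmxD adjmxN. Qed.

Lemma adjmxZ m n a (A : 'M[K]_(m, n)) : (a *: A) ^t* = a^* *: A ^t*.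
Proof. by rewrite linearZ map_mxZ. Qed.

Lemma adjmx0 m n : (0 : 'M[K]_(m, n)) ^t* = 0.
Proof. by rewrite trmx0 map_mx0. Qed.

Lemma adjmx1 n : (1%:M : 'M[K]_n) ^t* = 1%:M.
Proof. by rewrite trmx1 map_mx1. Qed.

Lemma adjmx_inv n (A : 'M[K]_n) : (invmx A) ^t* = invmx (A ^t*).
Proof. by rewrite trmx_inv map_invmx. Qed.

Lemma hermmxP n (M : 'M[K]_n) : reflect (M ^t* = M) (M \is hermsymmx).
Proof.
rewrite is_hermitianmxE expr0 scale1r.
by apply: (iffP eqP) => [{2}->|->].
Qed.

Definition sform n (M : 'M[K]_n) (x y : 'cV[K]_n) : K :=
  (x ^t* *m M *m y) 0 0.

Definition qform n (M : 'M[K]_n) (x : 'cV[K]_n) : K := sform M x x.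

Lemma sformDl n (M : 'M[K]_n) x y z :
  sform M (x + y) z = sform M x z + sform M y z.
Proof. by rewrite /sform adjmxD !mulmxDl mxE. Qed.

Lemma sformDr n (M : 'M[K]_n) x y z :
  sform M z (x + y) = sform M z x + sform M z y.
Proof. by rewrite /sform mulmxDr mxE. Qed.

Lemma sform0l n (M : 'M[K]_n) x : sform M 0 x = 0.
Proof. by rewrite /sform adjmx0 !mul0mx mxE. Qed.

Lemma sform0r n (M : 'M[K]_n) x : sform M x 0 = 0.
Proof. by rewrite /sform mulmx0 mxE. Qed.

Lemma sformZl n (M : 'M[K]_n) a x y : sform M (a *: x) y = a^* * sform M x y.
Proof. by rewrite /sform adjmxZ -!scalemxAl mxE. Qed.

Lemma sformZr n (M : 'M[K]_n) a x y : sform M x (a *: y) = a * sform M x y.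
Proof. by rewrite /sform -!scalemxAr mxE. Qed.

Lemma sform_suml n (M : 'M[K]_n) (I : Type) (r : seq I) (F : I -> 'cV[K]_n) y :
  sform M (\sum_(i <- r) F i) y = \sum_(i <- r) sform M (F i) y.
Proof.
exact: (big_morph (fun x => sform M x y) (fun x z => sformDl M x z y)
                  (sform0l M y)).
Qed.

Lemma sform_sumr n (M : 'M[K]_n) (I : Type) (r : seq I) (F : I -> 'cV[K]_n) x :
  sform M x (\sum_(i <- r) F i) = \sum_(i <- r) sform M x (F i).
Proof.
exact: (big_morph (sform M x) (fun y z => sformDr M y z x) (sform0r M x)).
Qed.

Lemma sform_mull n p (M : 'M[K]_n) (A : 'M[K]_(n, p)) x y :
  sform M (A *m x) (A *m y) = sform (A ^t* *m M *m A) x y.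
Proof. by rewrite /sform adjmxM !mulmxA. Qed.

Lemma sformDm n (M N : 'M[K]_n) x y :
  sform (M + N) x y = sform M x y + sform N x y.
Proof. by rewrite /sform mulmxDr mulmxDl mxE. Qed.

Lemma sformNm n (M : 'M[K]_n) x y : sform (- M) x y = - sform M x y.
Proof. by rewrite /sform mulmxN mulNmx mxE. Qed.

Lemma sform_conj n (M : 'M[K]_n) x y :
  M \is hermsymmx -> (sform M x y)^* = sform M y x.
Proof.
move=> /hermmxP hM.
have: (x ^t* *m M *m y) ^t* = y ^t* *m M *m x.
  by rewrite !adjmxM hM trmxCK mulmxA.
by move=> /matrixP/(_ 0 0); rewrite /sform !mxE.
Qed.

Lemma sform_delta n (M : 'M[K]_n) i j :
  sform M (delta_mx i 0) (delta_mx j 0) = M i j.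
Proof.
rewrite /sform trmx_delta map_delta_mx -rowE -colE.
by rewrite !mxE.
Qed.

Lemma qformDm n (M N : 'M[K]_n) x : qform (M + N) x = qform M x + qform N x.
Proof. exact: sformDm. Qed.

Lemma qformNm n (M : 'M[K]_n) x : qform (- M) x = - qform M x.
Proof. exact: sformNm. Qed.

Lemma qformBm n (M N : 'M[K]_n) x : qform (M - N) x = qform M x - qform N x.
Proof. by rewrite qformDm qformNm. Qed.

Lemma qform0 n (M : 'M[K]_n) : qform M 0 = 0.
Proof. exact: sform0l. Qed.

Lemma qformZ n (M : 'M[K]_n) a x : qform M (a *: x) = `|a| ^+ 2 * qform M x.
Proof. by rewrite /qform sformZl sformZr normCK; ring. Qed.

Lemma qform_mul n p (M : 'M[K]_n) (A : 'M[K]_(n, p)) x :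
  qform M (A *m x) = qform (A ^t* *m M *m A) x.
Proof. exact: sform_mull. Qed.

Lemma qformD n (M : 'M[K]_n) x y :
  qform M (x + y) = qform M x + sform M x y + sform M y x + qform M y.
Proof. by rewrite /qform sformDl !sformDr; ring. Qed.

(** Lets limits and vanishing of quadratic forms be transferred to matrix entries. *)
Lemma polarization n (M : 'M[K]_n) x y :
  sform M x y = ((qform M (x + y) - qform M x - qform M y) -
    'i * (qform M (x + 'i *: y) - qform M x - qform M y)) / 2.
Proof.
have ii : 'i * 'i = -1 :> K by rewrite -expr2 sqrCi.
rewrite !qformD qformZ sformZl sformZr conjCi normCi.
set a := sform M x y; set b := sform M y x.
by rewrite expr1n mul1r; field: ii.
Qed.

Lemma qform_real n (M : 'M[K]_n) x : M \is hermsymmx -> qform M x \is Num.real.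
Proof. by move=> hM; apply/CrealP; rewrite sform_conj. Qed.

Lemma qform1E n (x : 'cV[K]_n) : qform 1%:M x = \sum_i `|x i 0| ^+ 2.
Proof.
rewrite /qform /sform mulmx1 mxE; apply: eq_bigr => i _.
by rewrite !mxE normCK mulrC.
Qed.

Lemma qform1_ge0 n (x : 'cV[K]_n) : 0 <= qform 1%:M x.
Proof. by rewrite qform1E sumr_ge0 // => i _; rewrite exprn_ge0. Qed.

Lemma qform1_gt0 n (x : 'cV[K]_n) : x != 0 -> 0 < qform 1%:M x.
Proof.
move=> x0; rewrite lt_def qform1_ge0 andbT qform1E.
apply: contra x0; rewrite psumr_eq0 => [/allP x0|i _]; last by rewrite exprn_ge0.
apply/eqP/matrixP => i j; rewrite ord1 mxE.
by have := x0 i (mem_index_enum i); rewrite /= expf_eq0 normr_eq0 => /eqP.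
Qed.

Lemma posdefmx_ge0 n (M : 'M[K]_n) x : posdefmx M -> 0 <= qform M x.
Proof.
move=> [_ hM]; have [->|x0] := eqVneq x 0; first by rewrite qform0.
exact/ltW/hM.
Qed.

Lemma posdefmx_unit n (M : 'M[K]_n) : posdefmx M -> M \in unitmx.
Proof.
move=> [_ pM]; rewrite -unitmx_tr -row_free_unit -kermx_eq0.
apply/negPn/negP => /rowV0Pn [r /sub_kermxP rM r0].
have := pM r^T; rewrite trmx_eq0 => /(_ r0).
by rewrite -mulmxA -[M]trmxK -trmx_mul rM trmx0 mulmx0 mxE ltxx.
Qed.

Lemma eq0_mxP m n (S : 'M[K]_(m, n)) :
  (forall (r : 'cV[K]_m) (x : 'cV[K]_n), r ^t* *m S *m x = 0) -> S = 0.
Proof.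
move=> S0; apply/matrixP => i j.
have := S0 (delta_mx i 0) (delta_mx j 0).
rewrite trmx_delta map_delta_mx -rowE -colE => /matrixP /(_ 0 0).
by rewrite !mxE.
Qed.

(* Cauchy-Schwarz for [M] between [M^-1 e_i] and [x], summed over [i]. *)
Lemma qform1_le_trace_inv n (M : 'M[K]_n) x :
  posdefmx M -> qform 1%:M x <= \tr (invmx M) * qform M x.
Proof.
move=> pM; have uM := posdefmx_unit pM; have [hM _] := pM.
rewrite qform1E /mxtrace mulr_suml; apply: ler_sum => i _.
pose a : 'cV[K]_n := invmx M *m delta_mx i 0.
have aM : a ^t* *m M = delta_mx 0 i.
  have /hermmxP hM' := hM.
  by rewrite adjmxM adjmx_inv hM' mulmxKV // trmx_delta map_delta_mx.
have ax : sform M a x = x i 0 by rewrite /sform aM -rowE mxE.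
have aa : qform M a = invmx M i i.
  by rewrite /qform /sform aM /a -rowE -colE !mxE.
have a_gt0 : 0 < qform M a.
  apply: pM.2; apply/eqP => a0; have := congr1 (mulmx M) a0.
  rewrite mulKVmx // mulmx0 => /matrixP/(_ i 0).
  by rewrite !mxE !eqxx => /eqP; rewrite oner_eq0.
have ra : (qform M a)^* = qform M a by rewrite sform_conj.
have rt : (- (x i 0 / qform M a))^* = - ((x i 0)^* / qform M a).
  by rewrite rmorphN rmorphM fmorphV /= ra.
(* Nonnegativity of [M] at [x] minus its [M]-orthogonal projection on [a]; multiplying by
   [qform M a] gives the Cauchy-Schwarz inequality. *)
have := posdefmx_ge0 (x - (x i 0 / qform M a) *: a) pM.
rewrite qformD -scaleNr qformZ sformZr sformZl -(sform_conj a x hM) ax.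
rewrite !normCK rt -aa.
set q := qform M a in a_gt0 *; set c := x i 0; set X := qform M x => hX.
have qN : q != 0 by rewrite gt_eqF.
have := mulr_ge0 (ltW a_gt0) hX; rewrite -subr_ge0.
suff -> : q * (X + - (c / q) * c^* + - (c^* / q) * c
               + - (c / q) * - (c^* / q) * q) = q * X - c * c^* by [].
by field.
Qed.

End SesquilinearForms.

(** * Trajectories and Parseval's identity *)

Section DiscreteFourier.
Variables (K : numClosedFieldType) (L : nat) (w : K).
Hypothesis w_prim : L.-primitive_root w.

(** As [w] has modulus 1, conjugation inverts its powers. The sum is therefore geometric, and its
    ratio [c] is an [L]-th root of unity equal to 1 only if [k = l]. *)
Lemma prim_root_orthogonal (k l : 'I_L) :
  \sum_(j < L) (w ^+ j ^+ k)^* * w ^+ j ^+ l = if k == l then L%:R else 0.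
Proof.
have L0 := prim_order_gt0 w_prim; have wL : w ^+ L = 1 := prim_expr_order w_prim.
have norm_w : `|w| = 1.
  by apply/eqP; rewrite -(@pexpr_eq1 _ _ L) // -normrX wL normr1.
have conj_w i : (w ^+ i)^* = (w ^+ i)^-1.
  by rewrite invC_norm normrX norm_w !expr1n invr1 mul1r.
pose c := (w ^+ k)^* * w ^+ l.
have cE (j : 'I_L) : (w ^+ j ^+ k)^* * w ^+ j ^+ l = c ^+ j.
  by rewrite exprMn -!exprM mulnC (mulnC j) [w ^+ (k * j)]exprM rmorphXn.
under eq_bigr do rewrite cE.
have [kl|kl] := eqVneq k l.
  have -> : c = 1.
    rewrite /c kl conj_w mulVf // expf_neq0 // -normr_gt0 norm_w.
    exact: ltr01.
  under eq_bigr do rewrite expr1n.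
  by rewrite sumr_const card_ord.
have c1 : c != 1.
  apply: contra kl => /eqP c1; rewrite -val_eqE.
  have := eq_prim_root_expr w_prim k l; rewrite !modn_small // => <-.
  have wk0 : w ^+ k != 0.
    by rewrite expf_neq0 // -normr_gt0 norm_w ltr01.
  by rewrite -[w ^+ k]mulr1 -c1 /c conj_w mulVKf.
have cL : c ^+ L = 1.
  by rewrite exprMn -rmorphXn -!exprM mulnC (mulnC l) !exprM wL !expr1n rmorph1 mulr1.
have : (c - 1) * \sum_(j < L) c ^+ j = 0 by rewrite -subrX1 cL subrr.
by move/eqP; rewrite mulf_eq0 subr_eq0 (negPf c1) => /eqP.
Qed.

Lemma parseval p (M : 'M[K]_p) (y : nat -> 'cV[K]_p) :
  \sum_(j < L) qform M (\sum_(k < L) w ^+ j ^+ k *: y k)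
    = L%:R * \sum_(k < L) qform M (y k).
Proof.
under eq_bigr => j _.
  rewrite /qform sform_suml.
  under eq_bigr => k _.
    rewrite sform_sumr.
    under eq_bigr => l _ do rewrite sformZl sformZr mulrA.
    over.
  over.
rewrite exchange_big mulr_sumr; apply: eq_bigr => k _.
rewrite exchange_big (bigD1 k) //= -mulr_suml prim_root_orthogonal eqxx.
rewrite big1 ?addr0 // => l lk.
by rewrite -mulr_suml prim_root_orthogonal eq_sym (negPf lk) mul0r.
Qed.

End DiscreteFourier.

(** * Controlled trajectories, their cost and their energy *)

Section Trajectories.
Variables (K : numClosedFieldType) (n m : nat).
Variables (A : 'M[K]_n) (B : 'M[K]_(n, m)).
Implicit Types (u : nat -> 'cV[K]_m) (L Q P M : 'M[K]_n).

Fixpoint trajectory u k : 'cV[K]_n :=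
  if k is k'.+1 then A *m trajectory u k' + B *m u k else B *m u 0%N.

Definition cost L Q u N : K :=
  \sum_(k < N) qform L (trajectory u k) + qform Q (trajectory u N).

(** There are [N.+1] terms because the state at time [N] already depends on [u N]. *)
Definition energy u N : K := \sum_(k < N.+1) qform 1%:M (u k).

(* A lower bound [e] for the Toeplitz operator of the spectral density, in the
   time domain; [Q] accounts for the cost after time [N]. *)
Definition coercive L Q (e : K) : Prop :=
  forall u N, e * energy u N <= cost L Q u N.

Lemma eq_trajectory u v N :
  (forall k, (k <= N)%N -> u k = v k) -> trajectory u N = trajectory v N.
Proof.
elim: N => [|N IHN] uv /=; first by rewrite uv.
by rewrite uv // IHN // => k kN; rewrite uv // (leq_trans kN).
Qed.

Lemma eq_cost L Q u v N :
  (forall k, (k <= N)%N -> u k = v k) -> cost L Q u N = cost L Q v N.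
Proof.
move=> uv; rewrite /cost (eq_trajectory uv); congr (_ + _).
apply: eq_bigr => k _; congr qform; apply: eq_trajectory => j jk.
by rewrite uv // (leq_trans jk) // ltnW.
Qed.

Lemma eq_energy u v N :
  (forall k, (k <= N)%N -> u k = v k) -> energy u N = energy v N.
Proof. by move=> uv; apply: eq_bigr => k _; rewrite uv // -ltnS. Qed.

Lemma energy_ge0 u N : 0 <= energy u N.
Proof. by rewrite sumr_ge0 // => k _; exact: qform1_ge0. Qed.

Lemma costS L Q u N :
  cost L Q u N.+1 = \sum_(k < N) qform L (trajectory u k) +
    qform L (trajectory u N) + qform Q (A *m trajectory u N + B *m u N.+1).
Proof. by rewrite /cost big_ord_recr. Qed.

Lemma trajectoryE u N :
  trajectory u N = \sum_(k < N.+1) A ^+ k *m (B *m u (N - k)%N).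
Proof.
elim: N => [|N IHN] /=; first by rewrite big_ord1 expr0 mul1mx.
rewrite big_ord_recl expr0 mul1mx addrC IHN mulmx_sumr; congr (_ + _).
by apply: eq_bigr => k _; rewrite exprS mulmxA.
Qed.

Lemma reachable_trajectory (x : 'cV[K]_n) :
  reachable A B -> exists u N, trajectory u N = x.
Proof.
move=> /eqP /row_freeP [W hW].
have [v vx] : exists v : 'I_n -> 'cV[K]_m, \sum_(k < n) A ^+ k *m (B *m v k) = x.
  exists (submxcol (W *m x)).
  rewrite -[RHS]mul1mx -hW -mulmxA -[W *m x]submxcolK mul_mxrow_mxcol.
  by apply: eq_bigr => k _; rewrite submxcolK mulmxA.
(* To reach [x] at time [n], [v k] acts at time [n - k]. At time 0 the index [n] is out of range,
   and [insub] yields the default control 0. *)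
exists (fun i => oapp v 0 (insub (n - i)%N)), n.
rewrite trajectoryE big_ord_recr /= subnn subn0.
case: insubP => [k|_]; first by rewrite ltnn.
rewrite !mulmx0 addr0 -vx; apply: eq_bigr => k _.
by rewrite subKn ?valK // ltnW.
Qed.

Lemma reachable_eq0 p (r : 'M[K]_(p, n)) :
  reachable A B -> (forall k, r *m (A ^+ k *m B) = 0) -> r = 0.
Proof.
move=> /eqP /row_freeP [W hW] r0.
rewrite -[r]mulmx1 -hW mulmxA mul_mxrow.
have -> : \mxrow_(k < n) (r *m (A ^+ k *m B)) = 0.
  by apply/mxrowP => k; rewrite mxrowK r0; apply/matrixP => i j; rewrite !mxE.
by rewrite mul0mx.
Qed.

(** Telescoping: [A] maps each state to the next one minus its control term. The right side has the
    same shape as in [sum_qform_periodic], which allows the comparison with periodic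
    trajectories. *)
Lemma stein_cost P M u N : P - A ^t* *m P *m A = M ->
  cost M P u N = \sum_(k < N.+1)
    (qform P (trajectory u k) - qform P (trajectory u k - B *m u k)).
Proof.
move=> <-; elim: N => [|N IHN].
  by rewrite /cost big_ord0 big_ord1 add0r /= subrr qform0 subr0.
rewrite big_ord_recr -IHN costS /cost /= addrK qformBm qform_mul.
by rewrite -!addrA; congr (_ + _); ring.
Qed.

Lemma big_ord_trunc (V : zmodType) (F : nat -> V) N d :
  (forall k, (N <= k)%N -> F k = 0) -> \sum_(k < N + d) F k = \sum_(k < N) F k.
Proof.
move=> F0; elim: d => [|d IHd]; first by rewrite addn0.
by rewrite addnS big_ord_recr IHd /= F0 ?addr0 // leq_addr.
Qed.

(** * Periodic trajectories for controls that vanish after time [N] *)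

Section Periodic.
Variables (N d : nat) (w : K) (u : nat -> 'cV[K]_m).
Let L := (N.+1 + d)%N.
Hypothesis w_prim : L.-primitive_root w.
Hypothesis A_unit : 1%:M - A ^+ L \in unitmx.
Hypothesis u0 : forall k, (N < k)%N -> u k = 0.

(** The state of the [L]-periodic motion just before time 0: the solution [y] of
    [y = trajectory u L.-1 + A ^+ L *m y]. *)
Definition wrap : 'cV[K]_n := invmx (1%:M - A ^+ L) *m trajectory u L.-1.
Definition periodic_state k := trajectory u k + A ^+ k.+1 *m wrap.

Lemma periodic_stateS k :
  A *m periodic_state k = periodic_state k.+1 - B *m u k.+1.
Proof.
rewrite /periodic_state mulmxDr mulmxA -[A *m A ^+ _]exprS /=.
by rewrite addrAC addrK.
Qed.

Lemma periodic_state0 :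
  A *m periodic_state L.-1 = periodic_state 0 - B *m u 0.
Proof.
rewrite /periodic_state /= expr1 addrAC subrr add0r; congr (A *m _).
have : (1%:M - A ^+ L) *m wrap = trajectory u L.-1 by rewrite mulKVmx.
by rewrite mulmxBl mul1mx => <-; rewrite subrK.
Qed.

(** The discrete Fourier transform turns the recurrence into the resolvent equation; [z ^+ L = 1]
    makes the time shift cyclic. *)
Lemma periodic_state_transform z : z ^+ L = 1 ->
  (1%:M - z *: A) *m (\sum_(k < L) z ^+ k *: periodic_state k)
    = B *m (\sum_(k < L) z ^+ k *: u k).
Proof.
have LE : L = (N + d).+1 by [].
move=> zL; rewrite mulmxBl mul1mx -scalemxAl !mulmx_sumr scaler_sumr.
have y0 := periodic_state0; move: zL y0; rewrite LE /= => zL y0.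
rewrite [X in X - _]big_ord_recl [X in _ - X]big_ord_recr [RHS]big_ord_recl /=.
rewrite !expr0 !scale1r -scalemxAr scalerA -exprS zL scale1r y0.
under [X in _ - (X + _)]eq_bigr => k _.
  rewrite -scalemxAr periodic_stateS scalerA -exprS scalerBr.
  over.
under [in RHS]eq_bigr => k _ do rewrite -scalemxAr.
rewrite sumrB opprD !opprB [X in _ + X]addrC addrACA.
by congr (_ + _); rewrite addrC subrK.
Qed.

(** The telescoping of [stein_cost] around a cycle, hence without a terminal cost; times after [N]
    contribute nothing because no control acts there. *)
Lemma sum_qform_periodic M P : P - A ^t* *m P *m A = M ->
  \sum_(k < L) qform M (periodic_state k) = \sum_(k < N.+1)
    (qform P (periodic_state k) - qform P (periodic_state k - B *m u k)).
Proof.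
move=> <-; under eq_bigr do rewrite qformBm -qform_mul.
pose F k := qform P (periodic_state k) - qform P (periodic_state k - B *m u k).
rewrite -[RHS](@big_ord_trunc _ F _ d) => [|k Nk]; last first.
  by rewrite /F u0 // mulmx0 subr0 subrr.
rewrite !sumrB; congr (_ - _).
have LE : L = (N + d).+1 by [].
have y0 := periodic_state0; move: y0; rewrite LE /= => y0.
rewrite big_ord_recr [RHS]big_ord_recl /= y0 addrC; congr (_ + _).
by apply: eq_bigr => k _; rewrite periodic_stateS.
Qed.

(** After multiplication by the period, [parseval] moves both sides to the frequency domain. There
    the transformed state is [transfer A B z] applied to the transformed control, and the bound
    holds at each frequency. *)
Lemma periodic_dissipation P M e : P - A ^t* *m P *m A = M ->
  (forall z, z ^+ L = 1 -> 1%:M - z *: A \in unitmx) ->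
  (forall z v, z ^+ L = 1 ->
    e * qform 1%:M v <= qform M (transfer A B z *m v)) ->
  e * energy u N <= \sum_(k < N.+1)
    (qform P (periodic_state k) - qform P (periodic_state k - B *m u k)).
Proof.
move=> PM A_res circle; rewrite -(sum_qform_periodic PM).
have L_gt0 : 0 < L%:R :> K by rewrite ltr0n.
have -> : energy u N = \sum_(k < L) qform 1%:M (u k).
  apply/esym.
  apply: (@big_ord_trunc _ (fun k => qform 1%:M (u k)) N.+1 d) => k Nk.
  by rewrite u0 ?qform0.
rewrite -(ler_pM2l L_gt0) mulrCA -!(parseval w_prim) mulr_sumr.
apply: ler_sum => j _; set z := w ^+ j.
have zL : z ^+ L = 1.
  by rewrite -exprM mulnC exprM (prim_expr_order w_prim) expr1n.
have := circle z (\sum_(k < L) z ^+ k *: u k) zL.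
by rewrite /transfer -mulmxA -(periodic_state_transform zL) mulKmx ?A_res.
Qed.

End Periodic.
End Trajectories.

(** * Limits of complex matrices *)

Section ComplexLimits.
Variable R : realType.
Local Notation C := (R[i]).
Local Notation Re := complex.Re.
Local Notation Im := complex.Im.

(* [R[i]] carries no canonical topology here. *)
Definition ccvg (T : Type) (F : set_system T) (f : T -> C) (l : C) : Prop :=
  (Re (f t) @[t --> F] --> Re l) /\ (Im (f t) @[t --> F] --> Im l).

Definition mxcvg (T : Type) (F : set_system T) p q (f : T -> 'M[C]_(p, q))
    (l : 'M[C]_(p, q)) : Prop :=
  forall i j, ccvg F (fun t => f t i j) (l i j).

Section Filter.
Variables (T : Type) (F : set_system T).
Context {FF : Filter F}.

Lemma ccvg_cst l : ccvg F (fun _ => l) l.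
Proof. by split; exact: cvg_cst. Qed.

Lemma ccvgD f g l k :
  ccvg F f l -> ccvg F g k -> ccvg F (fun t => f t + g t) (l + k).
Proof.
have [ReD ImD] : (forall x y : C, Re (x + y) = Re x + Re y) /\
                 (forall x y : C, Im (x + y) = Im x + Im y).
  by split => -[a b] [c d].
move=> [fR fI] [gR gI]; split.
  by under eq_fun do rewrite ReD; rewrite ReD; exact: cvgD.
by under eq_fun do rewrite ImD; rewrite ImD; exact: cvgD.
Qed.

Lemma ccvgM f g l k :
  ccvg F f l -> ccvg F g k -> ccvg F (fun t => f t * g t) (l * k).
Proof.
have [ReM ImM] : (forall x y : C, Re (x * y) = Re x * Re y - Im x * Im y) /\
                 (forall x y : C, Im (x * y) = Re x * Im y + Im x * Re y).
  by split => -[a b] [c d].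
move=> [fR fI] [gR gI]; split.
  under eq_fun do rewrite ReM; rewrite ReM.
  by apply: cvgB; apply: cvgM.
under eq_fun do rewrite ImM; rewrite ImM.
by apply: cvgD; apply: cvgM.
Qed.

Lemma ccvgB f g l k :
  ccvg F f l -> ccvg F g k -> ccvg F (fun t => f t - g t) (l - k).
Proof.
move=> fl gk; apply: ccvgD => //; rewrite -mulN1r.
under eq_fun do rewrite -mulN1r.
by apply: ccvgM => //; exact: ccvg_cst.
Qed.

Lemma ccvg_conj f l : ccvg F f l -> ccvg F (fun t => (f t)^*) (l^*).
Proof.
have [ReJ ImJ] : (forall x : C, Re (Num.conj x) = Re x) /\
                 (forall x : C, Im (Num.conj x) = - Im x).
  by split => -[a b].
move=> [fR fI]; split.
  by under eq_fun do rewrite ReJ; rewrite ReJ.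
by under eq_fun do rewrite ImJ; rewrite ImJ; exact: cvgN.
Qed.

Lemma ccvgV f l : l != 0 -> ccvg F f l -> ccvg F (fun t => (f t)^-1) l^-1.
Proof.
have [ReV ImV] :
    (forall x : C, Re x^-1 = Re x / (Re x ^+ 2 + Im x ^+ 2)) /\
    (forall x : C, Im x^-1 = - (Im x / (Re x ^+ 2 + Im x ^+ 2))).
  by split => -[a b] //=; rewrite mulNr.
move=> l0 [fR fI].
have n0 : Re l ^+ 2 + Im l ^+ 2 != 0.
  apply: contra l0; rewrite paddr_eq0 ?sqr_ge0 // !sqrf_eq0 => n0.
  by rewrite eq_complex.
have fn : (Re (f t) ^+ 2 + Im (f t) ^+ 2)^-1 @[t --> F]
    --> (Re l ^+ 2 + Im l ^+ 2)^-1.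
  by apply: cvgV => //; apply: cvgD; apply: cvgM.
split.
  by under eq_fun do rewrite ReV; rewrite ReV; exact: cvgM.
by under eq_fun do rewrite ImV; rewrite ImV; apply: cvgN; exact: cvgM.
Qed.

Lemma ccvg_sum (I : Type) (r : seq I) (P : pred I) (f : I -> T -> C) l :
  (forall i, ccvg F (f i) (l i)) ->
  ccvg F (fun t => \sum_(i <- r | P i) f i t) (\sum_(i <- r | P i) l i).
Proof.
move=> fl; elim: r => [|i r IHr].
  by rewrite big_nil; under eq_fun do rewrite big_nil; exact: ccvg_cst.
rewrite big_cons; under eq_fun do rewrite big_cons.
by case: (P i) => //; exact: ccvgD.
Qed.

Lemma ccvg_prod (I : Type) (r : seq I) (P : pred I) (f : I -> T -> C) l :
  (forall i, ccvg F (f i) (l i)) ->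
  ccvg F (fun t => \prod_(i <- r | P i) f i t) (\prod_(i <- r | P i) l i).
Proof.
move=> fl; elim: r => [|i r IHr].
  by rewrite big_nil; under eq_fun do rewrite big_nil; exact: ccvg_cst.
rewrite big_cons; under eq_fun do rewrite big_cons.
by case: (P i) => //; exact: ccvgM.
Qed.

Lemma mxcvg_cst p q (M : 'M[C]_(p, q)) : mxcvg F (fun _ => M) M.
Proof. by move=> i j; exact: ccvg_cst. Qed.

Lemma mxcvgD p q (f g : T -> 'M[C]_(p, q)) l k :
  mxcvg F f l -> mxcvg F g k -> mxcvg F (fun t => f t + g t) (l + k).
Proof.
move=> fl gk i j; rewrite mxE; under eq_fun do rewrite mxE; exact: ccvgD.
Qed.

Lemma mxcvgZ p q (a : T -> C) (f : T -> 'M[C]_(p, q)) b l :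
  ccvg F a b -> mxcvg F f l -> mxcvg F (fun t => a t *: f t) (b *: l).
Proof.
move=> ab fl i j; rewrite mxE; under eq_fun do rewrite mxE; exact: ccvgM.
Qed.

Lemma mxcvgN p q (f : T -> 'M[C]_(p, q)) l :
  mxcvg F f l -> mxcvg F (fun t => - f t) (- l).
Proof.
move=> fl; rewrite -scaleN1r; under eq_fun do rewrite -scaleN1r.
by apply: mxcvgZ fl; exact: ccvg_cst.
Qed.

Lemma mxcvgB p q (f g : T -> 'M[C]_(p, q)) l k :
  mxcvg F f l -> mxcvg F g k -> mxcvg F (fun t => f t - g t) (l - k).
Proof. by move=> fl gk; apply: mxcvgD => //; exact: mxcvgN. Qed.

Lemma mxcvgM p q r (f : T -> 'M[C]_(p, q)) (g : T -> 'M[C]_(q, r)) l k :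
  mxcvg F f l -> mxcvg F g k -> mxcvg F (fun t => f t *m g t) (l *m k).
Proof.
move=> fl gk i j; rewrite mxE; under eq_fun do rewrite mxE.
by apply: ccvg_sum => o; exact: ccvgM.
Qed.

Lemma mxcvg_adj p q (f : T -> 'M[C]_(p, q)) l :
  mxcvg F f l -> mxcvg F (fun t => (f t) ^t*) (l ^t*).
Proof.
move=> fl i j; rewrite !mxE; under eq_fun do rewrite !mxE.
exact: ccvg_conj.
Qed.

Lemma ccvg_det p (f : T -> 'M[C]_p) l :
  mxcvg F f l -> ccvg F (fun t => \det (f t)) (\det l).
Proof.
move=> fl; apply: ccvg_sum => s; apply: ccvgM; first exact: ccvg_cst.
by apply: ccvg_prod => i; exact: fl.
Qed.

(** Stated with Cramer's formula because [invmx] returns its argument on a singular matrix, and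
    [f t] may be singular away from the limit. *)
Lemma mxcvg_cramer p (f : T -> 'M[C]_p) l : l \in unitmx -> mxcvg F f l ->
  mxcvg F (fun t => (\det (f t))^-1 *: \adj (f t)) (invmx l).
Proof.
move=> ul fl; rewrite /invmx ul; apply: mxcvgZ.
  by apply: ccvgV; [rewrite unitmxE unitfE in ul | exact: ccvg_det].
move=> i j; rewrite mxE; under eq_fun do rewrite mxE.
apply: ccvgM; first exact: ccvg_cst.
apply: ccvg_det => a b; rewrite !mxE; under eq_fun do rewrite !mxE.
exact: fl.
Qed.

Lemma mxcvg_inv p (f : T -> 'M[C]_p) l :
  (forall t, f t \in unitmx) -> l \in unitmx -> mxcvg F f l ->
  mxcvg F (fun t => invmx (f t)) (invmx l).
Proof.
move=> uf ul fl; under eq_fun do rewrite /invmx uf.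
exact: mxcvg_cramer.
Qed.

Lemma ccvg_qform p (f : T -> 'M[C]_p) (x : T -> 'cV[C]_p) l y :
  mxcvg F f l -> mxcvg F x y -> ccvg F (fun t => qform (f t) (x t)) (qform l y).
Proof.
move=> fl xy; apply: (mxcvgM (mxcvgM (mxcvg_adj xy) fl) xy).
Qed.

End Filter.

Section Proper.
Variables (T : Type) (F : set_system T).
Context {FF : ProperFilter F}.

Lemma ccvg_unique f l k : ccvg F f l -> ccvg F f k -> l = k.
Proof.
move=> [fR fI] [gR gI]; apply/eqP; rewrite eq_complex.
by rewrite (cvg_unique _ fR gR) // (cvg_unique _ fI gI) // !eqxx.
Qed.

Lemma mxcvg_unique p q (f : T -> 'M[C]_(p, q)) l k :
  mxcvg F f l -> mxcvg F f k -> l = k.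
Proof. by move=> fl fk; apply/matrixP => i j; exact: ccvg_unique (fl i j) (fk i j). Qed.

Lemma ccvg_ge0 f l : (forall t, 0 <= f t) -> ccvg F f l -> 0 <= l.
Proof.
move=> f0 [fR fI].
have [R0 I0] : (forall t, 0 <= Re (f t)) /\ (forall t, Im (f t) = 0).
  by split=> t; have := f0 t; rewrite lecE => /andP[/eqP ? ?].
rewrite lecE; apply/andP; split.
  have fI0 : Im (f t) @[t --> F] --> (0 : R).
    have -> : (fun t => Im (f t)) = (fun _ => 0) by apply/funext.
    exact: cvg_cst.
  by rewrite (cvg_unique _ fI fI0).
rewrite -(cvg_lim _ fR) //; apply: limr_ge; first by apply/cvg_ex; exists (Re l).
exact: nearW.
Qed.

Lemma ccvg_le f g l k : (forall t, f t <= g t) -> ccvg F f l -> ccvg F g k ->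
  l <= k.
Proof.
move=> fg fl gk; rewrite -subr_ge0.
apply: (@ccvg_ge0 (fun t => g t - f t)) => [t|]; first by rewrite subr_ge0.
exact: ccvgB.
Qed.

End Proper.
End ComplexLimits.

(** * Stable matrices and the Stein equation *)

Section StableMatrices.
Variable R : realType.
Local Notation C := (R[i]).
Local Notation Re := complex.Re.
Local Notation Im := complex.Im.

Lemma cvg0_recurrence (r : R) (d s : nat -> R) : 0 <= r < 1 ->
  (forall k, 0 <= d k) -> (forall k, d k.+1 <= r * d k + s k) ->
  (s k @[k --> \oo] --> 0) -> (d k @[k --> \oo] --> 0).
Proof.
move=> /andP[r0 r1] d0 dS s0; apply/cvgr0Pnorm_lt => e e0.
(* With this bound on [s], [e / 2] is the fixed point of the recurrence
   [t |-> r * t + (1 - r) * (e / 2)]. *)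
have e1 : 0 < (1 - r) * (e / 2) by rewrite mulr_gt0 ?subr_gt0 ?divr_gt0.
have [K _ hK] := (cvgr0Pnorm_lt _).1 s0 _ e1.
have hd j : d (K + j)%N <= r ^+ j * d K + e / 2.
  elim: j => [|j IHj].
    by rewrite addn0 expr0 mul1r lerDl divr_ge0 // ltW.
  rewrite addnS (le_trans (dS _)) //.
  have /ltW := le_lt_trans (ler_norm _) (hK (K + j)%N (leq_addr _ _)).
  have := ler_wpM2l r0 IHj; rewrite exprS; lra.
have e2 : 0 < e / 2 by rewrite divr_gt0.
have g0 : (r ^+ j * d K @[j --> \oo] --> 0).
  under eq_fun do rewrite mulrC.
  by apply: cvg_geometric; rewrite ger0_norm.
have [J _ hJ] := (cvgr0Pnorm_lt _).1 g0 _ e2.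
exists (K + J)%N => // k /= Kk; rewrite ger0_norm //.
have Kk' : (K <= k)%N := leq_trans (leq_addr _ _) Kk.
have := hd (k - K)%N; rewrite subnKC //.
have /hJ /= : (J <= k - K)%N by rewrite leq_subRL.
by move=> /(le_lt_trans (ler_norm _)); lra.
Qed.

Lemma ccvg0_normc (f : nat -> C) :
  ccvg \oo f 0 <-> (normc (f k) @[k --> \oo] --> 0).
Proof.
have n_ge0 (x : C) : 0 <= normc x by case: x => a b; exact: sqrtr_ge0.
have bd (x : C) : [/\ `|Re x| <= normc x, `|Im x| <= normc x
                    & normc x <= `|Re x| + `|Im x|].
  case: x => a b /=; split.
  - by rewrite -sqrtr_sqr ler_sqrt ?addr_ge0 ?sqr_ge0 // lerDl sqr_ge0.
  - by rewrite -sqrtr_sqr ler_sqrt ?addr_ge0 ?sqr_ge0 // lerDr sqr_ge0.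
  - rewrite -[X in _ <= X]ger0_norm ?addr_ge0 // -sqrtr_sqr.
    rewrite ler_sqrt ?sqr_ge0 // sqrrD !real_normK ?num_real //.
    by rewrite lerD2r lerDl mulrn_wge0 // mulr_ge0.
split=> [[fR fI]|f0].
  apply: (@squeeze_cvgr _ _ _ _ (fun _ => 0) (fun k => `|Re (f k)| + `|Im (f k)|)).
  - by apply: nearW => k; have [_ _ ->] := bd (f k); rewrite andbT n_ge0.
  - exact: cvg_cst.
  - by rewrite -[X in _ --> X]addr0 -(normr0 R); apply: cvgD; apply: cvg_norm.
split; apply/norm_cvg0P.
  apply: (@squeeze_cvgr _ _ _ _ (fun _ => 0) (fun k => normc (f k))) => //.
    by apply: nearW => k; have [-> _ _] := bd (f k); rewrite normr_ge0.
  exact: cvg_cst.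
apply: (@squeeze_cvgr _ _ _ _ (fun _ => 0) (fun k => normc (f k))) => //.
  by apply: nearW => k; have [_ -> _] := bd (f k); rewrite normr_ge0.
exact: cvg_cst.
Qed.

Lemma ccvg0_recurrence (a : C) (c e : nat -> C) : `|a| < 1 ->
  (forall k, c k.+1 = a * c k + e k) -> ccvg \oo e 0 -> ccvg \oo c 0.
Proof.
move=> a1 cS /ccvg0_normc e0; apply/ccvg0_normc.
have nE x : `|x| = (normc x)%:C%C by [].
apply: (@cvg0_recurrence (normc a) _ _ _ _ _ e0).
- by rewrite -ltcR -nE a1 andbT -lecR -nE normr_ge0.
- by move=> k; rewrite -lecR -nE normr_ge0.
- by move=> k; rewrite cS (le_trans (le_normcD _ _)) // normcM.
Qed.

(** One linear factor is peeled off at a time: [A ^+ k.+1 *m V] is [a] times [A ^+ k *m V] plus a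
    term tending to 0 by induction, so each entry obeys a contracting scalar recurrence. *)
Lemma mxcvg_pow_annihilated n (A : 'M[C]_n.+1) p (s : seq C)
    (V : 'M[C]_(n.+1, p)) :
  (forall a, a \in s -> `|a| < 1) -> \prod_(a <- s) (A - a%:M) *m V = 0 ->
  mxcvg \oo (fun k => A ^+ k *m V) 0.
Proof.
elim/last_ind: s V => [|s a IHs] V s1.
  rewrite big_nil mul1mx => ->; under eq_fun do rewrite mulmx0.
  exact: mxcvg_cst.
rewrite big_rcons /= -mulmxA => /IHs sV i j; rewrite mxE.
have a1 : `|a| < 1 by apply: s1; rewrite mem_rcons mem_head.
apply: (ccvg0_recurrence a1 (e := fun k => (A ^+ k *m ((A - a%:M) *m V)) i j)).
  move=> k.
  have -> : A ^+ k.+1 *m V =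
      a *: (A ^+ k *m V) + A ^+ k *m ((A - a%:M) *m V).
    rewrite mulmxBl mulmxBr mul_scalar_mx -scalemxAr addrC subrK.
    by rewrite exprSr -mulmxA.
  by rewrite mxE [X in X + _]mxE.
have s1' b : b \in s -> `|b| < 1.
  by move=> bs; apply: s1; rewrite mem_rcons in_cons bs orbT.
by have := sV s1' i j; rewrite mxE.
Qed.

(** By Cayley-Hamilton, the product of [A - a%:M] over the roots of the characteristic polynomial
    annihilates the identity. *)
Lemma mxcvg_pow n (A : 'M[C]_n) :
  spectrum_in_open_disc A -> mxcvg \oo (fun k => A ^+ k) 0.
Proof.
case: n A => [|n] A Astab; first by move=> [].
have [r rE] := closed_field_poly_normal (char_poly A).
have cE : char_poly A = \prod_(z <- r) ('X - z%:P).
  by rewrite rE (monicP (char_poly_monic A)) scale1r.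
have rA0 : \prod_(a <- r) (A - a%:M) *m 1%:M = 0.
  have := Cayley_Hamilton A; rewrite cE rmorph_prod /= mulmx1.
  by under eq_bigr do rewrite rmorphB /= horner_mx_X horner_mx_C.
have r1 a : a \in r -> `|a| < 1.
  by move=> ar; apply: Astab; rewrite eigenvalue_root_char cE root_prod_XsubC.
have := mxcvg_pow_annihilated r1 rA0.
by under eq_fun do rewrite mulmx1.
Qed.

Lemma mxcvg_subseq p q (f : nat -> 'M[C]_(p, q)) l (g : nat -> nat) :
  (forall k, (k <= g k)%N) -> mxcvg \oo f l -> mxcvg \oo (f \o g) l.
Proof.
move=> kg fl i j; have [fR fI] := fl i j.
have g_oo : g k @[k --> \oo] --> \oo.
  move=> P [N _ NP]; exists N => // k Nk; apply: NP => /=.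
  exact: leq_trans Nk (kg k).
by split; [exact: (cvg_comp _ _ g_oo fR)|exact: (cvg_comp _ _ g_oo fI)].
Qed.

(** A left kernel vector would be an eigenvector for [z^-1], of modulus at least 1. *)
Lemma resolvent_unit (K : numClosedFieldType) n (A : 'M[K]_n) z :
  spectrum_in_open_disc A -> `|z| <= 1 -> 1%:M - z *: A \in unitmx.
Proof.
move=> Astab z1; rewrite -row_free_unit -kermx_eq0.
apply/negPn/negP => /rowV0Pn [r /sub_kermxP rA r0].
have rE : r = z *: (r *m A).
  by apply/eqP; rewrite -subr_eq0 -rA mulmxBr mulmx1 scalemxAr.
have z0 : z != 0.
  by apply: contraNneq r0 => z0; rewrite rE z0 scale0r.
have /Astab : eigenvalue A z^-1.
  by apply/eigenvalueP; exists r => //; rewrite [in RHS]rE scalerA mulVf ?scale1r.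
rewrite normfV invf_lt1 ?normr_gt0 // => /(le_lt_trans z1).
by rewrite ltxx.
Qed.

(** A row fixed by [A ^+ l] is fixed by all [A ^+ (l * k)], which tend to 0. *)
Lemma one_sub_pow_unit n (A : 'M[C]_n) l :
  spectrum_in_open_disc A -> (0 < l)%N -> 1%:M - A ^+ l \in unitmx.
Proof.
move=> Astab l0; rewrite -row_free_unit -kermx_eq0.
apply/negPn/negP => /rowV0Pn [r /sub_kermxP rA r0].
have rE : r *m A ^+ l = r.
  by apply/eqP; rewrite eq_sym -subr_eq0 -rA mulmxBr mulmx1.
have rk k : r *m A ^+ (l * k) = r.
  elim: k => [|k IHk]; first by rewrite muln0 expr0 mulmx1.
  by rewrite mulnS exprD mulmxA rE IHk.
have A0 := mxcvg_subseq (fun k => leq_pmull k l0) (mxcvg_pow Astab).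
have : mxcvg \oo (fun k => r *m A ^+ (l * k)) (r *m 0).
  by apply: mxcvgM A0; exact: mxcvg_cst.
rewrite mulmx0; under eq_fun do rewrite rk.
move=> rl; have rE0 : r = 0 by apply: (mxcvg_unique _ rl); exact: mxcvg_cst.
by rewrite rE0 eqxx in r0.
Qed.

(** Iterating the equation puts [k]-th powers on both sides of [X], and these tend to 0. Two
    different matrices are allowed because uniqueness compares two closed loops. *)
Lemma stein_eq0 n (A1 A2 X : 'M[C]_n) :
  spectrum_in_open_disc A1 -> spectrum_in_open_disc A2 ->
  X = A1 ^t* *m X *m A2 -> X = 0.
Proof.
move=> /mxcvg_pow A1k /mxcvg_pow A2k XE.
have Xk k : X = (A1 ^+ k) ^t* *m X *m A2 ^+ k.
  elim: k => [|k IHk]; first by rewrite !expr0 adjmx1 mul1mx mulmx1.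
  have -> : A1 ^+ k.+1 = A1 *m A1 ^+ k by exact: exprS.
  have -> : A2 ^+ k.+1 = A2 *m A2 ^+ k by exact: exprS.
  by rewrite {1}IHk {1}XE adjmxM !mulmxA.
have : mxcvg \oo (fun k => (A1 ^+ k) ^t* *m X *m A2 ^+ k) (0 ^t* *m X *m 0).
  apply: mxcvgM A2k; apply: mxcvgM; first exact: mxcvg_adj.
  exact: mxcvg_cst.
rewrite mulmx0; under eq_fun do rewrite -Xk.
by move=> Xl; apply: (mxcvg_unique _ Xl); exact: mxcvg_cst.
Qed.

(** The Stein operator [f] is injective by [stein_eq0], hence bijective by finite dimension. *)
Lemma stein_solvable n (A M : 'M[C]_n) :
  spectrum_in_open_disc A -> exists P, P - A ^t* *m P *m A = M.
Proof.
move=> Astab.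
pose f := (idfun \- (mulmxr A \o mulmx (A ^t*)))%R : 'M[C]_n -> 'M[C]_n.
have f_free : row_free (lin_mx f).
  rewrite -kermx_eq0; apply/negPn/negP => /rowV0Pn [r /sub_kermxP rf r0].
  have := rf; rewrite -(vec_mxK r) mul_vec_lin => /eqP.
  rewrite mxvec_eq0 subr_eq0 => /eqP /(stein_eq0 Astab Astab) /eqP.
  by rewrite vec_mx_eq0 (negPf r0).
rewrite row_free_unit in f_free.
exists (vec_mx (mxvec M *m invmx (lin_mx f))).
apply: (can_inj mxvecK).
by rewrite -[LHS](mul_vec_lin f) vec_mxK mulmxKV.
Qed.

(** [P] and its adjoint solve the same equation, so [stein_eq0] applies to their difference. *)
Lemma stein_herm n (A P : 'M[C]_n) : spectrum_in_open_disc A ->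
  P - A ^t* *m P *m A \is hermsymmx -> P \is hermsymmx.
Proof.
move=> Astab /hermmxP hM; apply/hermmxP/eqP; rewrite -subr_eq0; apply/eqP.
apply: (stein_eq0 Astab Astab); move: hM.
rewrite adjmxB !adjmxM trmxCK mulmxBr mulmxBl mulmxA => /eqP.
rewrite subr_eq => /eqP h; rewrite {1}h addrAC [_ - P]addrAC subrr add0r.
by rewrite addrC.
Qed.

End StableMatrices.

(** * Positivity on the unit circle *)

Section UnitCircle.
Variable R : realType.
Local Notation C := (R[i]).

Lemma expi0 : expi 0 = 1 :> C.
Proof. by rewrite /expi cos0 sin0. Qed.

Lemma expiD (a b : R) : expi (a + b) = expi a * expi b.
Proof. by rewrite /expi cosD sinD; congr Complex; ring. Qed.

Lemma expiX (a : R) k : expi a ^+ k = expi (a *+ k).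
Proof. by elim: k => [|k IHk]; rewrite ?expi0 // exprS IHk -expiD mulrS. Qed.

Lemma norm_expi (a : R) : `|expi a| = 1.
Proof. by rewrite normc_def /= cos2Dsin2 sqrtr1. Qed.

Lemma expi_neq1 (a : R) : 0 < a < 2 * pi -> expi a != 1.
Proof.
move=> /andP[a0 a2]; rewrite eq_complex /= negb_and; apply/orP; left.
have s0 : 0 < sin (a / 2) by apply: sin_gt0_pi; apply/andP; split; lra.
have -> : a = (a / 2) *+ 2 by rewrite mulr2n; lra.
rewrite cos_mulr2n cos2sin2 neq_lt; apply/orP; left.
have := exprn_gt0 2 s0; rewrite mulr2n; lra.
Qed.

Lemma expi_prim_root l : (0 < l)%N -> l.-primitive_root (expi (2 * pi / l%:R) : C).
Proof.
move=> l0; rewrite /primitive_root_of_unity l0; apply/forallP => i.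
have l0' : 0 < l%:R :> R by rewrite ltr0n.
rewrite unity_rootE expiX -[_ / _ *+ _]mulr_natr.
have [->|il] := eqVneq i.+1 l.
  rewrite mulfVK; last by rewrite gt_eqF.
  have -> : 2 * pi = 0 + pi *+ 2 :> R by rewrite add0r mulr_natl.
  by rewrite /expi cosD2pi sinD2pi cos0 sin0 !eqxx.
rewrite eqbF_neg; apply: expi_neq1.
have il' : i.+1%:R < l%:R :> R by rewrite ltr_nat ltn_neqAle il ltn_ord.
have p0 := pi_gt0 R.
rewrite mulrAC divr_gt0 ?mulr_gt0 ?ltr0n //=.
by rewrite ltr_pdivrMr // ltr_pM2l // mulr_gt0.
Qed.

Lemma unity_root_expi l (z : C) : (0 < l)%N -> z ^+ l = 1 ->
  exists2 t, 0 <= t <= 2 * pi & z = expi t.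
Proof.
move=> l0 zl; have [j ->] := prim_rootP (expi_prim_root l0) zl.
exists (2 * pi / l%:R *+ j); last by rewrite expiX.
have l0' : 0 < l%:R :> R by rewrite ltr0n.
have p0 := pi_gt0 R.
rewrite mulrn_wge0 ?divr_ge0 ?mulr_ge0 ?ler0n ?(ltW p0) //=.
rewrite -[_ / _ *+ _]mulr_natr mulrAC ler_pdivrMr // ler_pM2l ?mulr_gt0 //.
by rewrite ler_nat ltnW.
Qed.

Lemma paraconj_expi p q (F : C -> 'M[C]_(p, q)) t :
  paraconj F (expi t) = (F (expi t)) ^t*.
Proof.
rewrite /paraconj; congr ((F _) ^t*).
by rewrite invC_norm norm_conjC norm_expi expr1n invr1 mul1r conjCK.
Qed.

End UnitCircle.

(** * From the unit circle to the time domain *)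

Section FrequencyDomain.
Variables (R : realType) (n m : nat).
Local Notation C := (R[i]).
Variables (A : 'M[C]_n) (B : 'M[C]_(n, m)).
Hypothesis A_stable : spectrum_in_open_disc A.

Lemma trajectory_free (u : nat -> 'cV[C]_m) N k :
  (forall j, (N < j)%N -> u j = 0) ->
  trajectory A B u (N + k) = A ^+ k *m trajectory A B u N.
Proof.
move=> u0; elim: k => [|k IHk]; first by rewrite addn0 expr0 mul1mx.
rewrite addnS /= IHk u0 ?ltnS ?leq_addr // mulmx0 addr0 mulmxA.
by congr (_ *m _); apply/esym; exact: exprS.
Qed.

(** As the period grows, [wrap] tends to 0: the last state is [A ^+ d] times the state at time [N],
    and the inverse in [wrap] tends to the identity. *)
Lemma mxcvg_periodic_state N (u : nat -> 'cV[C]_m) k :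
  (forall j, (N < j)%N -> u j = 0) ->
  mxcvg \oo (fun d => periodic_state A B N d u k) (trajectory A B u k).
Proof.
move=> u0; rewrite -[X in mxcvg _ _ X]addr0 -[X in _ + X](mulmx0 _ (A ^+ k.+1)).
apply: mxcvgD; first exact: mxcvg_cst.
apply: mxcvgM; first exact: mxcvg_cst.
rewrite -[X in mxcvg _ _ X](mulmx0 _ (invmx 1%:M)).
apply: mxcvgM.
  apply: mxcvg_inv => [d||]; [exact: one_sub_pow_unit|exact: unitmx1|].
  rewrite -[X in mxcvg _ _ X]subr0; apply: mxcvgB; first exact: mxcvg_cst.
  apply: (mxcvg_subseq (g := fun d => N.+1 + d)%N) (mxcvg_pow A_stable).
  by move=> d; exact: leq_addl.
have : mxcvg \oo (fun d => A ^+ d *m trajectory A B u N)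
                (0 *m trajectory A B u N).
  by apply: mxcvgM; [exact: mxcvg_pow|exact: mxcvg_cst].
by rewrite mul0mx; under eq_fun do rewrite -trajectory_free //.
Qed.

(** The controls, cut off after time [N], drive trajectories of period [N.+1 + d]. Their dissipation
    inequality passes to the limit in [d], where [stein_cost] identifies the right side with the
    cost. *)
Lemma stein_coercive (P M : 'M[C]_n) (e : C) : P - A ^t* *m P *m A = M ->
  (forall t v, 0 <= t <= 2 * pi ->
    e * qform 1%:M v <= qform M (transfer A B (expi t) *m v)) ->
  coercive A B M P e.
Proof.
move=> PM circle u N.
pose v k := if (k <= N)%N then u k else 0.
have uv k : (k <= N)%N -> u k = v k by rewrite /v => ->.
have v0 k : (N < k)%N -> v k = 0 by rewrite /v ltnNge => /negPf ->.
rewrite (eq_energy uv) (eq_cost _ _ _ _ uv) (stein_cost _ _ _ PM).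
pose F d := \sum_(k < N.+1) (qform P (periodic_state A B N d v k) -
  qform P (periodic_state A B N d v k - B *m v k)).
apply: (@ccvg_le _ _ \oo _ (fun _ => e * energy v N) F).
- move=> d; have L0 : (0 < N.+1 + d)%N by [].
  apply: (periodic_dissipation (expi_prim_root R L0) _ v0 PM).
  + exact: one_sub_pow_unit.
  + by move=> z /(unity_root_expi L0) [t _ ->]; rewrite resolvent_unit ?norm_expi.
  + by move=> z x /(unity_root_expi L0) [t t2 ->]; exact: circle.
- exact: ccvg_cst.
- apply: ccvg_sum => k; have yk := mxcvg_periodic_state k v0.
  apply: ccvgB; apply: ccvg_qform => //; try exact: mxcvg_cst.
  by apply: mxcvgB => //; exact: mxcvg_cst.
Qed.

Lemma transfer_nbhs (t : R) :
  mxcvg (nbhs t) (fun s => transfer A B (expi s)) (transfer A B (expi t)).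
Proof.
have ut s : 1%:M - expi s *: A \in unitmx.
  by apply: resolvent_unit; rewrite ?norm_expi.
apply: mxcvgM; last exact: mxcvg_cst.
apply: mxcvg_inv => //; apply: mxcvgB; first exact: mxcvg_cst.
apply: mxcvgZ; last exact: mxcvg_cst.
by split; [exact: continuous_cos|exact: continuous_sin].
Qed.

Lemma uniform_posdef (L : 'M[C]_n) : L \is hermsymmx ->
  (forall t, 0 <= t <= 2 * pi -> posdefmx
     ((transfer A B (expi t)) ^t* *m L *m transfer A B (expi t))) ->
  exists2 e : C, 0 < e & forall t v, 0 <= t <= 2 * pi ->
    e * qform 1%:M v <= qform L (transfer A B (expi t) *m v).
Proof.
move=> hL posp.
pose p t := (transfer A B (expi t)) ^t* *m L *m transfer A B (expi t).
(* The trace of the inverse in Cramer form: invertibility of [p t] is given on [[0, 2 * pi]] only,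
   while the limits are taken over full neighbourhoods. *)
pose f t := complex.Re (\tr ((\det (p t))^-1 *: \adj (p t))).
have pcont t : mxcvg (nbhs t) p (p t).
  apply: mxcvgM; last exact: transfer_nbhs.
  by apply: mxcvgM; [apply: mxcvg_adj; exact: transfer_nbhs|exact: mxcvg_cst].
have fE t : 0 <= t <= 2 * pi -> \tr (invmx (p t)) = (f t)%:C%C.
  move=> /posp pt; have up := posdefmx_unit pt.
  have -> : f t = complex.Re (\tr (invmx (p t))) by rewrite /f /invmx up.
  rewrite RRe_real //; apply/CrealP.
  have /hermmxP hp := pt.1.
  rewrite -{2}(hp : (p t) ^t* = p t) -adjmx_inv /mxtrace rmorph_sum.
  by apply: eq_bigr => i _; rewrite !mxE.
have pi2 : 0 <= 2 * pi :> R by rewrite mulr_ge0 ?pi_ge0.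
have [t0 t0P fmax] : exists2 c, c \in `[0, 2 * pi]%R &
    forall t, t \in `[0, 2 * pi]%R -> f t <= f c.
  apply: EVT_max => //; apply: continuous_in_subspaceT => t.
  rewrite inE /= in_itv /= => /posp /posdefmx_unit ut.
  have pl := mxcvg_cramer ut (pcont t).
  have [] : ccvg (nbhs t) (fun s => \tr ((\det (p s))^-1 *: \adj (p s)))
                 (\tr (invmx (p t))).
    by apply: ccvg_sum => i; exact: pl.
  by rewrite /invmx ut.
(* By [qform1_le_trace_inv], the inverse of any positive bound on the trace serves as [e]; adding 1
   covers the case [f t0 = 0]. *)
have b0 : 0 < `|f t0| + 1 by rewrite ltr_wpDl.
exists ((`|f t0| + 1)^-1)%:C%C; first by rewrite ltcR invr_gt0.
move=> t v ht; rewrite qform_mul -/(p t) fmorphV /=.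
rewrite ler_pdivrMl ?ltcR //.
have tr_le : \tr (invmx (p t)) <= (`|f t0| + 1)%:C%C.
  rewrite (fE t ht) lecR; apply: le_trans (fmax t _) _; first by rewrite in_itv.
  by rewrite (le_trans (ler_norm _)) // lerDl.
apply: le_trans (qform1_le_trace_inv v (posp t ht)) _.
by apply: ler_wpM2r tr_le; apply: posdefmx_ge0; exact: posp.
Qed.

End FrequencyDomain.

(** * The Riccati equation *)

Section Riccati.
Variables (R : realType) (n m : nat).
Local Notation C := (R[i]).
Variables (A L : 'M[C]_n) (B : 'M[C]_(n, m)).
Hypothesis L_herm : L \is hermsymmx.
Implicit Types (Q : 'M[C]_n).

Definition innovation Q : 'M[C]_m := B ^t* *m Q *m B.
Definition gain Q : 'M[C]_(m, n) := invmx (innovation Q) *m (B ^t* *m Q).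
(** For Hermitian [Q] with positive definite [innovation Q], this is the minimum over [u] of
    [qform Q (y + B *m u)] as a form in [y]; [riccati] is then the Bellman operator with stage cost
    [L]. *)
Definition schur_compl Q : 'M[C]_n :=
  Q - (gain Q) ^t* *m innovation Q *m gain Q.
Definition riccati Q : 'M[C]_n := L + A ^t* *m schur_compl Q *m A.

Section Gain.
Variable Q : 'M[C]_n.
Hypothesis Q_herm : Q \is hermsymmx.

Lemma innovation_herm : innovation Q \is hermsymmx.
Proof.
apply/hermmxP; have /hermmxP hQ := Q_herm.
by rewrite !adjmxM hQ trmxCK mulmxA.
Qed.

Lemma schur_compl_herm : schur_compl Q \is hermsymmx.
Proof.
apply/hermmxP; have /hermmxP hQ := Q_herm; have /hermmxP hO := innovation_herm.
rewrite adjmxB (adjmxM _ (gain Q)) (adjmxM (_ ^t*)) hQ hO.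
by rewrite trmxCK mulmxA.
Qed.

Lemma riccati_herm : riccati Q \is hermsymmx.
Proof.
apply/hermmxP; have /hermmxP hL := L_herm; have /hermmxP hS := schur_compl_herm.
by rewrite adjmxD (adjmxM _ A) (adjmxM (_ ^t*)) hL hS trmxCK !mulmxA.
Qed.

Hypothesis innovation_unit : innovation Q \in unitmx.

Lemma gain_mul : gain Q *m B = 1%:M.
Proof. by rewrite /gain -mulmxA mulVmx. Qed.

Lemma schur_compl_mul : schur_compl Q *m B = 0.
Proof.
have /hermmxP hQ := Q_herm; have /hermmxP hO := innovation_herm.
rewrite mulmxBl -(mulmxA _ (gain Q)) gain_mul mulmx1 /gain.
rewrite (adjmxM (invmx _)) (adjmxM (B ^t*)) adjmx_inv hO.
by rewrite hQ trmxCK mulmxKV // subrr.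
Qed.

(** There are no cross terms because the Hermitian matrix [schur_compl Q] kills [B]; in the
    remaining part, [gain Q] is a left inverse of [B]. *)
Lemma qform_complete_square y u :
  qform Q (y + B *m u) =
    qform (schur_compl Q) y + qform (innovation Q) (gain Q *m y + u).
Proof.
have QE : Q = schur_compl Q + (gain Q) ^t* *m innovation Q *m gain Q.
  by rewrite subrK.
rewrite {1}QE qformDm -qform_mul mulmxDr (mulmxA (gain Q)) gain_mul mul1mx.
congr (_ + _).
have SB : sform (schur_compl Q) ^~ (B *m u) =1 fun _ => 0.
  by move=> z; rewrite /sform -mulmxA (mulmxA _ B) schur_compl_mul mul0mx mulmx0 mxE.
rewrite qformD -(sform_conj y (B *m u) schur_compl_herm) /qform !SB.
by rewrite conjC0 !addr0.
Qed.

End Gain.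

(** This is coercivity at [N = 0], where the only state is [B *m x]. *)
Lemma coercive_innovation Q e : Q \is hermsymmx -> 0 < e ->
  coercive A B L Q e -> posdefmx (innovation Q).
Proof.
move=> Q_herm e0 cQ; split; first exact: innovation_herm.
move=> x x0; have := cQ (fun _ => x) 0%N.
rewrite /energy big_ord1 /cost big_ord0 add0r /= qform_mul; apply: lt_le_trans.
by rewrite mulr_gt0 ?qform1_gt0.
Qed.

(** One step of dynamic programming; [qform_riccatiE] exhibits the control attaining the bound. *)
Lemma qform_riccati_le Q x u : Q \is hermsymmx -> posdefmx (innovation Q) ->
  qform (riccati Q) x <= qform L x + qform Q (A *m x + B *m u).
Proof.
move=> Q_herm pQ; rewrite qform_complete_square ?posdefmx_unit //.
by rewrite qformDm -qform_mul lerD2l lerDl posdefmx_ge0.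
Qed.

Lemma qform_riccatiE Q x : Q \is hermsymmx -> posdefmx (innovation Q) ->
  qform (riccati Q) x =
    qform L x + qform Q (A *m x + B *m (- (gain Q *m (A *m x)))).
Proof.
move=> Q_herm pQ; rewrite qform_complete_square ?posdefmx_unit //.
by rewrite subrr qform0 addr0 qformDm -qform_mul.
Qed.

(* Prolonging the controls [u] by the minimiser of the last step turns the
   cost for [Q] into the cost for [riccati Q]. *)
Lemma coercive_riccati Q e : Q \is hermsymmx -> 0 < e ->
  coercive A B L Q e -> coercive A B L (riccati Q) e.
Proof.
move=> Q_herm e0 cQ u N; have pQ := coercive_innovation Q_herm e0 cQ.
pose b := - (gain Q *m (A *m trajectory A B u N)).
pose v k := if (k <= N)%N then u k else b.
have uv k : (k <= N)%N -> u k = v k by rewrite /v => ->.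
have vN : v N.+1 = b by rewrite /v ltnn.
have := cQ v N.+1; rewrite costS vN /energy big_ord_recr /= vN.
rewrite -(eq_trajectory _ _ uv) -/(energy v N) -(eq_energy uv).
rewrite -addrA -qform_riccatiE //.
have -> : \sum_(k < N) qform L (trajectory A B v k) =
          \sum_(k < N) qform L (trajectory A B u k).
  apply: eq_bigr => k _; congr qform; apply: eq_trajectory => j jk.
  by rewrite uv // (leq_trans jk) // ltnW.
apply: le_trans; apply: ler_wpM2l; first exact: ltW.
by rewrite lerDl qform1_ge0.
Qed.

(** The optimal control for [Q2] is used as a competitor for [Q1]. *)
Lemma riccati_mono Q1 Q2 : Q1 \is hermsymmx -> Q2 \is hermsymmx ->
  posdefmx (innovation Q1) -> posdefmx (innovation Q2) ->
  (forall x, qform Q1 x <= qform Q2 x) ->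
  forall x, qform (riccati Q1) x <= qform (riccati Q2) x.
Proof.
move=> h1 h2 p1 p2 Q12 x; rewrite [leRHS](qform_riccatiE x h2 p2).
by apply: le_trans (qform_riccati_le x _ h1 p1) _; rewrite lerD2l.
Qed.

(** Monotone convergence gives a limit of the form at each vector, and polarization then gives one
    for each entry. *)
Lemma decreasing_qform_cvg (Q : nat -> 'M[C]_n) :
  (forall k, Q k \is hermsymmx) ->
  (forall k x, qform (Q k.+1) x <= qform (Q k) x) ->
  (forall x, exists b, forall k, b <= qform (Q k) x) ->
  exists l, mxcvg \oo Q l.
Proof.
move=> hQ dQ bQ.
have QE k x : qform (Q k) x = (complex.Re (qform (Q k) x))%:C%C.
  by rewrite RRe_real ?qform_real.
have q_cvg x : exists l, ccvg \oo (fun k => qform (Q k) x) l.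
  have [b hb] := bQ x.
  have /cvg_ex[l hl] : cvgn (fun k => complex.Re (qform (Q k) x)).
    apply: nonincreasing_is_cvgn.
      by apply/nonincreasing_seqP => k; have := dQ k x; rewrite lecE => /andP[].
    exists (complex.Re b) => _ [k _ <-].
    by have := hb k; rewrite lecE => /andP[].
  exists l%:C%C; split => //=.
  have -> : (fun k => complex.Im (qform (Q k) x)) = (fun _ => 0).
    by apply/funext => k; rewrite QE.
  exact: cvg_cst.
have [g hg] := choice q_cvg.
pose s x y := ((g (x + y) - g x - g y) - 'i * (g (x + 'i *: y) - g x - g y)) / 2.
exists (\matrix_(i, j) s (delta_mx i 0) (delta_mx j 0)) => i j.
rewrite mxE; under eq_fun do rewrite -sform_delta polarization.
apply: ccvgM; last exact: ccvg_cst.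
apply: ccvgB; first by apply: ccvgB => //; exact: ccvgB.
apply: ccvgM; first exact: ccvg_cst.
by apply: ccvgB => //; exact: ccvgB.
Qed.

Lemma coercive_riccati_fixpoint Q0 e : reachable A B ->
  Q0 \is hermsymmx -> Q0 - A ^t* *m Q0 *m A = L -> 0 < e ->
  coercive A B L Q0 e ->
  exists Q, [/\ Q \is hermsymmx, coercive A B L Q e & Q = riccati Q].
Proof.
move=> reach h0 Q0E e0 c0.
have [Q [Q_0 QS]] : exists Q : nat -> 'M[C]_n,
    Q 0%N = Q0 /\ forall k, Q k.+1 = riccati (Q k).
  by exists (fun k => iter k riccati Q0).
have [hQ cQ] : (forall k, Q k \is hermsymmx) /\ (forall k, coercive A B L (Q k) e).
  have hc k : Q k \is hermsymmx /\ coercive A B L (Q k) e.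
    elim: k => [|k [hk ck]]; first by rewrite Q_0.
    by rewrite QS; split; [exact: riccati_herm|exact: coercive_riccati].
  by split=> k; have [] := hc k.
have pQ k := coercive_innovation (hQ k) e0 (cQ k).
have dQ k x : qform (Q k.+1) x <= qform (Q k) x.
  elim: k x => [|k IHk] x.
    (* The zero control bounds the first iterate by [L + A^* Q0 A], which is [Q0]. *)
    have := qform_riccati_le x 0 (hQ 0%N) (pQ 0%N).
    by rewrite -QS mulmx0 addr0 -{1}Q0E Q_0 qformBm -qform_mul subrK.
  by rewrite [Q k.+2]QS [X in _ <= qform X _]QS; exact: riccati_mono.
(* Coercivity along controls leading to [x] bounds the terminal cost from below by a quantity
   independent of [k]. *)
have bQ x : exists b, forall k, b <= qform (Q k) x.
  have [u [N <-]] := reachable_trajectory x reach.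
  exists (- \sum_(k < N) qform L (trajectory A B u k)) => k.
  rewrite -subr_ge0 opprK addrC; apply: le_trans (cQ k u N).
  by rewrite mulr_ge0 ?energy_ge0 ?ltW.
have [l Ql] := decreasing_qform_cvg hQ dQ bQ.
have hl : l \is hermsymmx.
  apply/hermmxP; apply: (mxcvg_unique _ Ql).
  have := mxcvg_adj Ql; under eq_fun => k do rewrite (hermmxP _ (hQ k)).
  exact.
(* The bound [e] survives the limit; this keeps [innovation l] invertible, so the gains converge
   too. *)
have cl : coercive A B L l e.
  move=> u N; apply: (@ccvg_le _ _ \oo _ (fun _ => e * energy u N)
      (fun k => cost A B L (Q k) u N)) => [k||]; first exact: cQ.
    exact: ccvg_cst.
  apply: ccvgD; first exact: ccvg_cst.
  by apply: ccvg_qform => //; exact: mxcvg_cst.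
exists l; split => //.
have pl := coercive_innovation hl e0 cl.
have Ol : mxcvg \oo (innovation \o Q) (innovation l).
  by do 2?[apply: mxcvgM => //; try exact: mxcvg_cst].
have Gl : mxcvg \oo (gain \o Q) (gain l).
  apply: mxcvgM.
    exact: (mxcvg_inv (fun k => posdefmx_unit (pQ k)) (posdefmx_unit pl) Ol).
  by apply: mxcvgM => //; exact: mxcvg_cst.
apply: (@mxcvg_unique _ _ \oo _ _ _ (riccati \o Q)).
  have -> : riccati \o Q = Q \o S by apply/funext => k; rewrite /= QS.
  exact: mxcvg_subseq.
apply: mxcvgD; first exact: mxcvg_cst.
apply: mxcvgM; last exact: mxcvg_cst.
apply: mxcvgM; first exact: mxcvg_cst.
apply: mxcvgB => //.
by apply: mxcvgM => //; apply: mxcvgM => //; exact: mxcvg_adj.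
Qed.

End Riccati.

(** * Stability and uniqueness *)

Section Factorization.
Variables (R : realType) (n m : nat).
Local Notation K := (R[i]).
Variables (A : 'M[K]_n) (B : 'M[K]_(n, m)).
Hypothesis A_stable : spectrum_in_open_disc A.

Lemma transfer_spec z : 1%:M - z *: A \in unitmx ->
  transfer A B z = z *: (A *m transfer A B z) + B.
Proof.
move=> uz; have : (1%:M - z *: A) *m transfer A B z = B by rewrite mulKVmx.
by rewrite mulmxBl mul1mx -scalemxAl => /eqP; rewrite subr_eq addrC => /eqP.
Qed.

(** By [transfer_spec], [A *m g] is [z^-1 *: (g - B)] and the adjoint of [A *m h] carries the factor
    [z]. The scalars cancel, and the terms in [B] vanish since [P *m B = 0]. *)
Lemma paraconj_kyp (P M : 'M[K]_n) z : P \is hermsymmx -> P *m B = 0 ->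
  P - A ^t* *m P *m A = M -> regular_point A z ->
  paraconj (transfer A B) z *m M *m transfer A B z = 0.
Proof.
move=> /hermmxP hP PB <- [z0 uz uz'].
have BP : B ^t* *m P = 0 by rewrite -hP -adjmxM PB adjmx0.
set g := transfer A B z; pose h := transfer A B (Num.conj z)^-1.
have -> : paraconj (transfer A B) z = h ^t* by [].
have Ag : A *m g = z^-1 *: (g - B).
  by rewrite /g {2}(transfer_spec uz) addrK scalerA mulVf // scale1r.
have Ah : A *m h = Num.conj z *: (h - B).
  rewrite /h {2}(transfer_spec uz') addrK scalerA mulfV ?scale1r //.
  by rewrite conjC_eq0.
clearbody g h; rewrite mulmxBr mulmxBl.
have -> : h ^t* *m (A ^t* *m P *m A) *m g = (A *m h) ^t* *m P *m (A *m g).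
  by rewrite adjmxM !mulmxA.
rewrite Ah Ag adjmxZ conjCK -!scalemxAl -scalemxAr scalerA mulfV // scale1r.
rewrite adjmxB mulmxBl BP subr0 mulmxBr -(mulmxA _ P B) PB mulmx0 subr0.
exact: subrr.
Qed.

Lemma archimedean_bound (a c : K) : 0 < a -> ~ forall j : nat, a *+ j <= c.
Proof.
move=> a0 ac.
have aR : 0 < complex.Re a by move: a0; rewrite ltcE => /andP[].
have RN j : complex.Re (a *+ j) = complex.Re a *+ j.
  by elim: j => [|j IHj]; rewrite ?mulr0n // !mulrS -IHj; case: (a) (a *+ j) => ? ? [].
have c0 : 0 <= complex.Re c / complex.Re a.
  by have := ac 0%N; rewrite mulr0n lecE => /andP[_ c0]; rewrite divr_ge0 // ltW.
have := archi_boundP c0; rewrite ltr_pdivrMr // mulrC mulr_natr ltNge -RN.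
by have := ac (Num.bound (complex.Re c / complex.Re a)); rewrite lecE => /andP[_ ->].
Qed.

Variable L : 'M[K]_n.
Hypothesis L_herm : L \is hermsymmx.

(* If [C *m transfer A B z] has kernel vector [v], the controls
   [z^-1 ^+ j *: v] started at [transfer A B z *m v] have constant cost
   although their energy is unbounded. *)
Lemma coercive_det_neq0 Q e : reachable A B -> Q \is hermsymmx -> 0 < e ->
  coercive A B L Q e -> Q = riccati A L B Q ->
  forall z, `|z| <= 1 -> \det (gain B Q *m transfer A B z) != 0.
Proof.
move=> reach hQ e0 cQ QE z z1.
have pO := coercive_innovation hQ e0 cQ; have uO := posdefmx_unit pO.
rewrite -det_tr; apply/negP => /det0P [r r0 rG].
pose v : 'cV[K]_m := r^T; pose x := transfer A B z *m v.
have v0 : v != 0 by rewrite trmx_eq0.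
have Cx : gain B Q *m x = 0.
  by apply: trmx_inj; rewrite mulmxA trmx_mul trmxK rG trmx0.
have xE : x = z *: (A *m x) + B *m v.
  rewrite /x {1}(transfer_spec (resolvent_unit A_stable z1)).
  by rewrite mulmxDl -scalemxAl (mulmxA A (transfer A B z)).
have z0 : z != 0.
  apply: contraNneq v0 => z0; apply/eqP; move: Cx; rewrite xE z0 scale0r add0r.
  by rewrite mulmxA gain_mul // mul1mx.
pose l := z^-1.
have l1 : 1 <= `|l| by rewrite normfV invf_ge1 // normr_gt0.
have Ax : A *m x = l *: (x - B *m v).
  by rewrite [in RHS]xE addrK scalerA mulVf // scale1r.
have [u [N uN]] := reachable_trajectory x reach.
pose w k := if (k <= N)%N then u k else l ^+ (k - N) *: v.
have wu k : (k <= N)%N -> u k = w k by rewrite /w => ->.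
have wE j : w (N + j.+1)%N = l ^+ j.+1 *: v.
  by rewrite /w leqNgt addnS ltnS leq_addr /= -addnS addKn.
have traj_w j : trajectory A B w (N + j) = l ^+ j *: x.
  elim: j => [|j IHj]; first by rewrite addn0 expr0 scale1r -uN (eq_trajectory _ _ wu).
  rewrite addnS /= -addnS IHj wE -!scalemxAr Ax scalerA -exprSr.
  by rewrite -scalerDr subrK.
(* The gain sends [x - B *m v] to [- v], so [v] is the optimal control there and [qform Q x = qform
   (schur_compl B Q) (x - B *m v)]; the Riccati equation then balances the stage cost. *)
have qform_step b : qform L (b *: x) + qform Q (l *: (b *: x)) = qform Q (b *: x).
  have QS y : gain B Q *m y = 0 -> qform Q y = qform (schur_compl B Q) y.
    move=> Cy; have := qform_complete_square hQ uO y 0.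
    by rewrite mulmx0 !addr0 Cy qform0 addr0.
  rewrite [RHS](congr1 (fun M => qform M _) QE) qformDm -qform_mul; congr (_ + _).
  rewrite -scalemxAr Ax [b *: (l *: _)]scalerA mulrC -scalerA !qformZ; congr (_ * (_ * _)).
  have := qform_complete_square hQ uO (x - B *m v) v.
  rewrite subrK => ->.
  rewrite mulmxBr Cx mulmxA gain_mul // mul1mx sub0r addNr qform0 addr0.
  by [].
have cost_w j : cost A B L Q w (N + j) = cost A B L Q w N.
  elim: j => [|j IHj]; first by rewrite addn0.
  rewrite -IHj addnS costS /cost -addrA; congr (_ + _).
  rewrite -[A *m _ + _]/(trajectory A B w (N + j).+1) -addnS !traj_w.
  by rewrite exprS -scalerA qform_step.
(* Here [|z| <= 1] enters: as [|l| >= 1], each new control adds at least [qform 1%:M v]. *)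
have energy_w j : qform 1%:M v *+ j <= energy w (N + j).
  elim: j => [|j IHj]; first by rewrite mulr0n energy_ge0.
  rewrite mulrSr addnS /energy big_ord_recr lerD //= -addnS wE qformZ.
  by rewrite ler_peMl ?qform1_ge0 // normrX -exprM exprn_ege1.
apply: (@archimedean_bound (e * qform 1%:M v) (cost A B L Q w N)).
  by rewrite mulr_gt0 ?qform1_gt0.
move=> j; rewrite -(cost_w j); apply: le_trans (cQ w (N + j)%N).
by rewrite -mulrnAr; apply: ler_wpM2l; [exact: ltW|exact: energy_w].
Qed.

Lemma cost_opp P M u N : cost A B (- M) (- P) u N = - cost A B M P u N.
Proof.
rewrite /cost qformNm opprD; congr (_ + _).
by rewrite -sumrN; apply: eq_bigr => k _; rewrite qformNm.
Qed.

(** The cases [b = 1] and [b = 'i] give sum 0 and difference 0 for the two mixed values. *)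
Lemma sform_alternating_eq0 (x y : 'cV[K]_n) (P : 'M[K]_n) :
  (forall b, sform P x (b *: y) + sform P (b *: y) x = 0) -> sform P y x = 0.
Proof.
move=> h; have := h 1; have := h 'i; rewrite !scale1r sformZl sformZr conjCi.
set c := sform P x y; set d := sform P y x => h1 h2.
have i0 : 'i != 0 :> K := neq0Ci K.
have cd : c = - d by apply/eqP; rewrite -addr_eq0 h2.
move: h1; rewrite cd mulrN mulNr -opprD -mulr2n => /eqP.
by rewrite oppr_eq0 mulrn_eq0 /= mulf_eq0 (negPf i0) => /eqP.
Qed.

(** [stein_coercive] with [e = 0], for [M] and for [- M], makes every cost vanish; varying the last
    control then isolates the products of [P] with [B]. *)
Lemma vanishing_on_circle P M : reachable A B -> P \is hermsymmx ->
  P - A ^t* *m P *m A = M ->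
  (forall t v, 0 <= t <= 2 * pi -> qform M (transfer A B (expi t) *m v) = 0) ->
  P *m B = 0.
Proof.
move=> reach hP PM M0.
have cost0 u N : cost A B M P u N = 0.
  apply/eqP; rewrite eq_le -oppr_ge0 -cost_opp.
  have c1 : coercive A B M P 0.
    by apply: stein_coercive => // t v /M0 ->; rewrite mul0r.
  have c2 : coercive A B (- M) (- P) 0.
    apply: stein_coercive => // [|t v /M0 h].
      by rewrite -PM mulmxN mulNmx opprB opprK addrC.
    by rewrite qformNm h oppr0 mul0r.
  by have := c1 u N; have := c2 u N; rewrite !mul0r => -> ->.
have PB0 b : qform P (B *m b) = 0.
  by have := cost0 (fun _ => b) 0%N; rewrite /cost big_ord0 add0r.
(* Every [x] is the state at some time [N]; the identity is the difference of the vanishing costs up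
   to [N.+1] and up to [N]. *)
have PAB x b : qform P (A *m x + B *m b) = qform P (A *m x).
  have [u [N <-]] := reachable_trajectory x reach.
  pose w k := if (k <= N)%N then u k else b.
  have wu k : (k <= N)%N -> u k = w k by rewrite /w => ->.
  have wN : w N.+1 = b by rewrite /w ltnn.
  have := cost0 w N.+1; have := cost0 w N.
  rewrite costS /cost wN -(eq_trajectory _ _ wu) -PM qformBm -qform_mul.
  by rewrite addrA => ->; rewrite sub0r addrC => /eqP; rewrite subr_eq0 => /eqP.
have BPA0 : B ^t* *m P *m A = 0.
  apply: eq0_mxP => b x.
  apply/matrixP => i j; rewrite !ord1 [RHS]mxE.
  have : sform P (B *m b) (A *m x) = 0.
    apply: sform_alternating_eq0 => c; have := PAB x (c *: b).
    rewrite qformD PB0 addr0 -addrA -scalemxAr => /eqP.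
    by rewrite addrC -subr_eq0 addrK => /eqP.
  by rewrite /sform adjmxM !mulmxA.
have BPB0 : B ^t* *m P *m B = 0.
  apply: eq0_mxP => a b; apply/matrixP => i j; rewrite !ord1 [RHS]mxE.
  have := polarization P (B *m a) (B *m b).
  rewrite scalemxAr -!mulmxDr !PB0 !subrr mulr0 subrr mul0r.
  by rewrite /sform adjmxM !mulmxA.
have : B ^t* *m P = 0.
  apply: (reachable_eq0 reach) => -[|k]; first by rewrite expr0 mul1mx.
  have -> : A ^+ k.+1 = A *m A ^+ k by exact: exprS.
  by rewrite !mulmxA BPA0 !mul0mx.
move/(congr1 (fun X => X ^t*)); rewrite adjmxM trmxCK adjmx0.
by have /hermmxP -> := hP.
Qed.

(** A left eigenvector [r] for [a] with [|a| >= 1] kills [B] and equals [s *m C] times the resolvent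
    at [a^-1]; so [s] is a left kernel vector of [C *m transfer A B a^-1]. *)
Lemma closed_loop_stable (C : 'M[K]_(m, n)) : C *m B = 1%:M ->
  (forall z, `|z| <= 1 -> \det (C *m transfer A B z) != 0) ->
  spectrum_in_open_disc (A *m (1%:M - B *m C)).
Proof.
move=> CB hdet a /eigenvalueP [r rE r0].
have [//|a1] := real_ltP (normr_real a) (real1 _).
have a0 : a != 0 by rewrite -normr_gt0 (lt_le_trans ltr01).
have z1 : `|a^-1| <= 1 by rewrite normfV invf_le1 // normr_gt0.
have rz : r = a^-1 *: (r *m (A *m (1%:M - B *m C))).
  by rewrite rE scalerA mulVf // scale1r.
have uz := resolvent_unit A_stable z1.
pose s := - (a^-1 *: (r *m A *m B)).
have rA : r *m (1%:M - a^-1 *: A) = s *m C.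
  rewrite mulmxBr mulmx1 {1}rz -scalemxAr -scalerBr !mulmxBr mulmx1.
  by rewrite addrAC subrr sub0r scalerN mulNmx -scalemxAl !mulmxA.
have rE' : r = s *m C *m invmx (1%:M - a^-1 *: A) by rewrite -rA mulmxK.
have rB : r *m B = 0.
  by rewrite rz -scalemxAl -!mulmxA mulmxBl mul1mx -mulmxA CB mulmx1 subrr !mulmx0 scaler0.
have s0 : s != 0.
  by apply: contraNneq r0 => s0; rewrite rE' s0 !mul0mx.
have /negP[] := hdet _ z1; apply/det0P; exists s => //.
by rewrite /transfer !mulmxA -rE'.
Qed.

(** Sandwiching between the adjoint of [J1] and [J2] fixes both [P1] and [P2]. It removes the term
    of [C1] from the left and that of [C2] from the right, so [P1 - P2] solves a homogeneous Stein
    equation for the two closed loops. *)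
Lemma stabilizing_kyp_unique (P1 P2 : 'M[K]_n) (C1 C2 : 'M[K]_(m, n))
    (O1 O2 : 'M[K]_m) :
  P1 \is hermsymmx -> P2 \is hermsymmx ->
  P1 *m B = 0 -> P2 *m B = 0 -> C1 *m B = 1%:M -> C2 *m B = 1%:M ->
  O1 \is hermsymmx ->
  P1 - A ^t* *m P1 *m A = L - C1 ^t* *m O1 *m C1 ->
  P2 - A ^t* *m P2 *m A = L - C2 ^t* *m O2 *m C2 ->
  spectrum_in_open_disc (A *m (1%:M - B *m C1)) ->
  spectrum_in_open_disc (A *m (1%:M - B *m C2)) -> P1 = P2.
Proof.
move=> /hermmxP h1 /hermmxP h2 PB1 PB2 CB1 CB2 /hermmxP hO1 E1 E2 S1 S2.
pose J1 := 1%:M - B *m C1; pose J2 := 1%:M - B *m C2.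
have CJ1 : J1 ^t* *m C1 ^t* = 0.
  by rewrite -adjmxM mulmxBr mulmx1 mulmxA CB1 mul1mx subrr adjmx0.
have CJ2 : C2 *m J2 = 0 by rewrite mulmxBr mulmx1 mulmxA CB2 mul1mx subrr.
have JP (P : 'M[K]_n) : P ^t* = P -> P *m B = 0 -> J1 ^t* *m P *m J2 = P.
  move=> hP PB; have PJ : P *m J2 = P by rewrite mulmxBr mulmx1 mulmxA PB mul0mx subr0.
  rewrite -mulmxA PJ -{1}hP -adjmxM mulmxBr mulmx1 mulmxA PB mul0mx subr0.
  exact: hP.
rewrite -/J1 in S1; rewrite -/J2 in S2; clearbody J1 J2.
have F1 : P1 - J1 ^t* *m (A ^t* *m P1 *m A) *m J2 = J1 ^t* *m L *m J2.
  rewrite -{1}(JP _ h1 PB1) -mulmxBl -mulmxBr E1 mulmxBr !mulmxA CJ1.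
  by rewrite !mul0mx subr0.
have F2 : P2 - J1 ^t* *m (A ^t* *m P2 *m A) *m J2 = J1 ^t* *m L *m J2.
  rewrite -{1}(JP _ h2 PB2) -mulmxBl -mulmxBr E2 mulmxBr mulmxBl.
  by rewrite -!mulmxA CJ2 !mulmx0 subr0.
apply/eqP; rewrite -subr_eq0; apply/eqP; apply: (stein_eq0 S1 S2).
move: F1; rewrite -F2 => /eqP; rewrite subr_eq addrAC -addrA -mulmxBl -mulmxBr.
rewrite -mulmxBl -mulmxBr addrC -subr_eq adjmxM !mulmxA => /eqP.
exact.
Qed.

End Factorization.

(** * Recovering the pair, and the conclusion *)

Lemma paraconj_mull (K : numClosedFieldType) p q r (C : 'M[K]_(p, q))
    (G : K -> 'M[K]_(q, r)) z :
  paraconj (fun z => C *m G z) z = paraconj G z *m C ^t*.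
Proof. by rewrite /paraconj adjmxM. Qed.

Lemma regular_point_expi (R : realType) n (A : 'M[R[i]]_n) t :
  spectrum_in_open_disc A -> regular_point A (expi t).
Proof.
move=> Astab; split; first by rewrite -normr_gt0 norm_expi ltr01.
  by rewrite resolvent_unit ?norm_expi.
by rewrite resolvent_unit // normfV norm_conjC norm_expi invr1.
Qed.

(** Multiplying by the adjoint of [B] on the left gives [O1 *m C1 = O2 *m C2]; multiplying by [B] on
    the right then gives [O1 = O2]. *)
Lemma gram_gain_unique (K : numClosedFieldType) n m (B : 'M[K]_(n, m))
    (C1 C2 : 'M[K]_(m, n)) (O1 O2 : 'M[K]_m) :
  C1 *m B = 1%:M -> C2 *m B = 1%:M -> O1 \in unitmx ->
  C1 ^t* *m O1 *m C1 = C2 ^t* *m O2 *m C2 -> (C1, O1) = (C2, O2).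
Proof.
move=> CB1 CB2 uO1 E.
have BC1 : B ^t* *m C1 ^t* = 1%:M by rewrite -adjmxM CB1 adjmx1.
have BC2 : B ^t* *m C2 ^t* = 1%:M by rewrite -adjmxM CB2 adjmx1.
have OC : O1 *m C1 = O2 *m C2.
  by have := congr1 (mulmx (B ^t*)) E; rewrite !mulmxA BC1 BC2 !mul1mx.
have O12 : O1 = O2.
  by have := congr1 (mulmxr B) OC; rewrite /= -!mulmxA CB1 CB2 !mulmx1.
by rewrite -O12 -(mulKmx uO1 C1) OC -O12 mulKmx.
Qed.

Local Open Scope complex_scope.
Local Open Scope sesquilinear_scope.

Theorem theorem1p1 (R : realType) (n m : nat)
    (Lambda : 'M[R[i]]_n) (A : 'M[R[i]]_n) (B : 'M[R[i]]_(n, m)) :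
  Lambda \is hermsymmx ->
  reachable A B ->
  \rank B = m ->
  spectrum_in_open_disc A ->
  let G : R[i] -> 'M[R[i]]_(n, m) := transfer A B in
  let p : R[i] -> 'M[R[i]]_m := fun z => paraconj G z *m Lambda *m G z in
  (forall theta : R, 0 <= theta <= 2 * pi -> posdefmx (p (expi theta))) ->
  exists! COmega : 'M[R[i]]_(m, n) * 'M[R[i]]_m,
    let C := COmega.1 in
    let Omega := COmega.2 in
    let sigma : R[i] -> 'M[R[i]]_m := fun z => C *m G z in
    possemidefmx Omega /\
    (forall z : R[i], regular_point A z ->
       p z = paraconj sigma z *m Omega *m sigma z /\
       paraconj sigma z *m Omega *m sigma z
         = paraconj G z *m C ^t* *m Omega *m C *m G z) /\
    C *m B = 1%:M /\
    posdefmx Omega /\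
    (forall z : R[i], `|z| <= 1 -> \det (sigma z) != 0).
Proof.
move=> hL reach _ Astab G p posp.
have sandwichB z (C : 'M[R[i]]_(m, n)) (O : 'M[R[i]]_m) :
    paraconj G z *m (Lambda - C ^t* *m O *m C) *m G z =
    p z - paraconj (fun z => C *m G z) z *m O *m (C *m G z).
  by rewrite paraconj_mull mulmxBr mulmxBl /p !mulmxA.
have posp' t : 0 <= t <= 2 * pi ->
    posdefmx ((G (expi t)) ^t* *m Lambda *m G (expi t)).
  by move=> /posp; rewrite /p paraconj_expi.
have [e e0 he] := uniform_posdef Astab hL posp'.
have [Q0 Q0E] := stein_solvable Lambda Astab.
have h0 : Q0 \is hermsymmx by apply: (stein_herm Astab); rewrite Q0E.
have c0 := stein_coercive Astab Q0E he.
have [Q [hQ cQ QE]] := coercive_riccati_fixpoint hL reach h0 Q0E e0 c0.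
have pO := coercive_innovation hQ e0 cQ; have uO := posdefmx_unit pO.
have hdet := coercive_det_neq0 Astab reach hQ e0 cQ QE.
have CB := gain_mul uO.
have hP := schur_compl_herm B hQ; have PB := schur_compl_mul hQ uO.
(* The Riccati fixed-point equation, read as a Stein equation for the Schur complement. *)
have P_stein : schur_compl B Q - A ^t* *m schur_compl B Q *m A =
    Lambda - (gain B Q) ^t* *m innovation B Q *m gain B Q.
  by rewrite {1}/schur_compl [X in X - _ - _]QE addrAC /riccati addrK.
exists (gain B Q, innovation B Q); split.
  split; first by split; [exact: pO.1|move=> x; exact: posdefmx_ge0 pO].
  split; last by [].
  move=> z zreg; split; last by rewrite paraconj_mull !mulmxA.
  apply/eqP; rewrite -subr_eq0 -sandwichB; apply/eqP.
  exact: paraconj_kyp hP PB P_stein zreg.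
move=> [C2 O2] /= [_ [fact2 [CB2 [pO2 hdet2]]]].
(* A second factorization also comes from a Stein solution, and equality on the circle will force
   [P2 *m B = 0]. *)
have [P2 P2E] := stein_solvable (Lambda - C2 ^t* *m O2 *m C2) Astab.
have hO2 := pO2.1.
have hP2 : P2 \is hermsymmx.
  apply: (stein_herm Astab); rewrite P2E; apply/hermmxP.
  have /hermmxP hL' := hL; have /hermmxP hO2' := hO2.
  by rewrite adjmxB !adjmxM hL' hO2' trmxCK !mulmxA.
have P2B : P2 *m B = 0.
  apply: (vanishing_on_circle Astab reach hP2 P2E) => t v _.
  have [pt _] := fact2 _ (regular_point_expi t Astab).
  have := sandwichB (expi t) C2 O2; rewrite pt subrr paraconj_expi.
  by rewrite qform_mul => ->; rewrite /qform /sform mulmx0 mul0mx mxE.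
have P12 := stabilizing_kyp_unique hP hP2 PB P2B CB CB2 pO.1 P_stein P2E
  (closed_loop_stable Astab CB hdet) (closed_loop_stable Astab CB2 hdet2).
apply: (gram_gain_unique CB CB2 uO); apply: (addrI (- Lambda)).
by apply: oppr_inj; rewrite !opprD !opprK -P_stein -P2E P12.
Qed.
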